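(* Let $n\ge 2$, let $\Omega\subset\mathbb{C}$ be a domain, let $f:\Omega\to\mathbb{C}$ be analytic, and assume that there exists a unique $\alpha\in\Omega$ such that $f(\alpha)=0$. Let $A\in\mathcal{M}_n(\mathbb{C})$ and let $\lambda_1,\dots,\lambda_n$ be the eigenvalues of $A$ listed with algebraic multiplicity. The equation $XA-AX=f(X)$ admits a solution $X\in\mathcal{M}_n(\mathbb{C})$ with $\sigma(X)\subset\Omega$ and $X\neq\alpha I_n$ if and only if there exist indices $i\neq j$ such that $\lambda_i-\lambda_j=f'(\alpha)$.
   Context: $\mathcal{M}_n(\mathbb{C})$ is the set of complex $n\times n$ matrices, $I_n$ the identity matrix and $\sigma(X)$ the spectrum of $X$. For $X$ with $\sigma(X)\subset\Omega$, $f(X)$ is the primary matrix function $f(X)=\frac{1}{2i\pi}\int_{\Gamma}f(z)(zI_n-X)^{-1}dz$, where $\Gamma$ is a counterclockwise oriented closed contour in $\Omega$ enclosing $\sigma(X)$ (holomorphic functional calculus). *)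

(* Defs.v *)
(* MathComp / MathComp-Analysis; the complex numbers are R[i], for R : realType. *)
From mathcomp Require Export all_boot all_order all_algebra complex.
From mathcomp Require Export all_classical all_reals all_analysis.

Set Implicit Arguments.
Unset Strict Implicit.
Unset Printing Implicit Defensive.

Export Order.TTheory GRing.Theory Num.Theory numFieldNormedType.Exports.

Local Open Scope classical_set_scope.
Local Open Scope complex_scope.
Local Open Scope ring_scope.

(* R[i] carries its usual topology and norm only through its regular-algebra
   alias R[i]^o, which is convertible to R[i]. *)

Definition is_domain (R : realType) (Omega : set R[i]^o) : Prop :=
  [/\ open Omega, connected Omega & Omega !=set0].

(* f is total, but only its values on Omega matter. *)
Definition analytic_on (R : realType) (Omega : set R[i]^o)
    (f : R[i]^o -> R[i]^o) : Prop :=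
  forall z0, Omega z0 -> exists a : nat -> R[i]^o,
    \forall z \near z0, series (fun k => a k * (z - z0) ^+ k) @ \oo --> f z.

Definition cderiv (R : realType) (f : R[i]^o -> R[i]^o) (z : R[i]^o) : R[i] :=
  derive1 f z.

Section Contours.
Variable R : realType.

(* An arc is the restriction to [0, 1] of some g : R -> R[i]. Asking g to be C^1
   on the whole line loses no generality: a map that is C^1 on [0, 1], with
   one-sided derivatives at the endpoints, extends affinely to a C^1 map on R. *)
Definition C1_real (u : R -> R) : Prop :=
  (forall t, derivable u t 1) /\ continuous (derive1 u).

Definition C1_arc (g : R -> R[i]) : Prop :=
  C1_real (fun t => complex.Re (g t)) /\ C1_real (fun t => complex.Im (g t)).

Definition arc_deriv (g : R -> R[i]) (t : R) : R[i] :=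
  (derive1 (fun s => complex.Re (g s)) t) +i* (derive1 (fun s => complex.Im (g s)) t).

Definition cintegral01 (h : R -> R[i]) : R[i] :=
  (\int[lebesgue_measure]_(t in `[0%R, 1%R]) complex.Re (h t)) +i*
  (\int[lebesgue_measure]_(t in `[0%R, 1%R]) complex.Im (h t)).

Definition arc_integral (g : R -> R[i]) (F : R[i] -> R[i]) : R[i] :=
  cintegral01 (fun t => F (g t) * arc_deriv g t).

(* A piecewise C^1 closed curve, given by its successive C^1 arcs: each arc
   ends where the next one starts, and the last one ends where the first one
   starts. *)
Definition closed_contour (Gamma : seq (R -> R[i])) : Prop :=
  (forall k, (k < size Gamma)%N -> C1_arc (nth (fun=> 0) Gamma k)) /\
  cycle (fun g h : R -> R[i] => g 1 == h 0) Gamma.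

Definition contour_image (Gamma : seq (R -> R[i])) : set R[i]^o :=
  [set z | exists k t, [/\ (k < size Gamma)%N, 0 <= t <= 1 &
                           z = nth (fun=> 0) Gamma k t]].

Definition contour_integral (Gamma : seq (R -> R[i])) (F : R[i] -> R[i]) : R[i] :=
  \sum_(g <- Gamma) arc_integral g F.

Definition two_i_pi : R[i] := 0 +i* (2 * pi).

Definition winding (Gamma : seq (R -> R[i])) (w : R[i]) : R[i] :=
  two_i_pi^-1 * contour_integral Gamma (fun z => (z - w)^-1).

Definition spectrum (n : nat) (X : 'M[R[i]]_n) : set R[i]^o :=
  [set z | eigenvalue X z].

(* Gamma is a closed contour in Omega which goes around each point of the
   spectrum of X once, counterclockwise. The last clause says that everything
   Gamma encloses belongs to Omega; it is what makes the Cauchy integral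
   independent of Gamma when Omega is not simply connected. *)
Definition encloses (Omega : set R[i]^o) (n : nat) (X : 'M[R[i]]_n)
    (Gamma : seq (R -> R[i])) : Prop :=
  [/\ closed_contour Gamma,
      contour_image Gamma `<=` Omega `\` spectrum X,
      (forall w, spectrum X w -> winding Gamma w = 1) &
      (forall w, ~ Omega w -> winding Gamma w = 0)].

Definition cauchy_matrix (f : R[i] -> R[i]) (n : nat) (X : 'M[R[i]]_n)
    (Gamma : seq (R -> R[i])) : 'M[R[i]]_n :=
  \matrix_(i, j) (two_i_pi^-1 *
    contour_integral Gamma (fun z => f z * invmx (z%:M - X) i j)).

(* Y = f(X). By Cauchy's theorem all admissible contours give the same matrix,
   and since Omega is open and connected there is one as soon as the spectrum
   of X lies in Omega. *)
Definition is_matrix_function (Omega : set R[i]^o) (f : R[i] -> R[i])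
    (n : nat) (X Y : 'M[R[i]]_n) : Prop :=
  exists2 Gamma, encloses Omega X Gamma & Y = cauchy_matrix f X Gamma.

End Contours.

(* Main.v *)
From mathcomp Require Import ring lra.
Require Import Defs.

Set Implicit Arguments.
Unset Strict Implicit.
Unset Printing Implicit Defensive.

Local Open Scope classical_set_scope.
Local Open Scope complex_scope.
Local Open Scope ring_scope.

(** The argument has an algebraic half and an analytic half.

    Suppose that X solves the equation and put Y = f(X) = XA - AX. Since Y is a
    commutator that commutes with X, it is nilpotent ([kleinecke]). By spectral
    mapping ([cauchy_matrix_eigen]) f vanishes on the spectrum of X, so alpha is
    the only eigenvalue of X and N = X - alpha I is nilpotent; it is not 0. Only
    the first two Taylor coefficients of f matter now: f(X) = f'(alpha) N + N^2 G
    for some polynomial G in N ([cauchy_matrix_nilpotent]), so the equation reads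
    NA - AN = f'(alpha) N + N^2 G. Take m with N^m nonzero and N^(m+1) = 0. The
    range of N^m is stable under A and contains a right eigenvector v of A, for
    an eigenvalue nu, and the equation then yields a left eigenvector u of A, in
    the row space of N, for the eigenvalue nu + f'(alpha)
    ([nilpotent_solution_pair]); moreover u v = 0. Conversely, if u is a left
    eigenvector for mu, v a right eigenvector for nu, u v = 0 and
    mu - nu = f'(alpha), then N = v u has square 0 and X = alpha I + N is a
    solution ([rank_one_solution]). It remains to see that two eigenvalues
    lambda_i = mu and lambda_j = nu have distinct indices exactly when there are
    such u and v with u v = 0: the characteristic polynomial of A is 'X - mu
    times the characteristic polynomial of A on the kernel of u
    ([eigenvalue_pair]). This treats f'(alpha) = 0 like every other value.

    The values of the Cauchy integrals that define f(X) are needed for an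
    arbitrary closed contour in Omega whose winding number is 0 outside Omega.
    They come from the homology form of Cauchy's theorem, proved after Dixon: the
    integral over z of (f(z) - f(w)) / (z - w), for w in Omega, and of
    f(z) / (z - w), for w outside Omega, define together one function of w. It is
    locally the sum of a power series ([dixon_expansion]) and tends to 0 at
    infinity ([dixon_infinity]), hence vanishes by Liouville's theorem, which
    follows from the local maximum principle ([expansion_vanish_infinity]). Its
    value and its first derivative give the integral formulas for f and f'
    ([cauchy_formula], [cauchy_formula_deriv]).

    Analyticity is used throughout in a quantitative form, [has_expansion]:
    a function is locally the sum of a power series, with a geometric bound on
    every remainder. *)

(** * The modulus of a complex number *)

Section ComplexNorm.
Variable R : realType.
Local Notation C := (R[i]).
Implicit Types (x y z w : C).

(** The modulus, as a real number; the norm of R[i] takes its values in R[i]. *)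
Definition cmod z : R := Normc.normc z.

Lemma normE z : `|z| = (cmod z)%:C. Proof. by []. Qed.

Lemma cmod0 : cmod 0 = 0. Proof. exact: Normc.normc0. Qed.
Lemma cmod1 : cmod 1 = 1. Proof. exact: Normc.normc1. Qed.

Lemma cmod_ge0 z : 0 <= cmod z.
Proof. by case: z => a b; rewrite /cmod /= sqrtr_ge0. Qed.

Lemma cmodM x y : cmod (x * y) = cmod x * cmod y.
Proof. exact: Normc.normcM. Qed.

Lemma cmodV x : cmod x^-1 = (cmod x)^-1.
Proof. exact: Normc.normcV. Qed.

Lemma cmodN x : cmod (- x) = cmod x.
Proof. exact: normcN. Qed.

Lemma cmodX x n : cmod (x ^+ n) = cmod x ^+ n.
Proof. by elim: n => [|n IH]; rewrite ?expr0 ?cmod1 // !exprS cmodM IH. Qed.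

Lemma cmodD x y : cmod (x + y) <= cmod x + cmod y.
Proof. exact: le_normcD. Qed.

Lemma cmodB x y : cmod (x - y) = cmod (y - x).
Proof. by rewrite -cmodN opprB. Qed.

Lemma cmodBD x y : cmod (x - y) <= cmod x + cmod y.
Proof. by rewrite -(cmodN y) cmodD. Qed.

Lemma cmod_eq0 x : (cmod x == 0) = (x == 0).
Proof.
apply/eqP/eqP => [|->]; [exact: Normc.eq0_normc | exact: cmod0].
Qed.

Lemma cmod_gt0 x : (0 < cmod x) = (x != 0).
Proof. by rewrite lt_def cmod_ge0 andbT cmod_eq0. Qed.

Lemma cmod_real (a : R) : 0 <= a -> cmod a%:C = a.
Proof.
by move=> a0; rewrite /cmod /= expr0n /= addr0 sqrtr_sqr ger0_norm.
Qed.

Lemma cmod_sum (I : Type) (r : seq I) (P : pred I) (F : I -> C) :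
  cmod (\sum_(i <- r | P i) F i) <= \sum_(i <- r | P i) cmod (F i).
Proof.
elim/big_rec2: _ => [|i a b _ H]; first by rewrite cmod0.
by rewrite (le_trans (cmodD _ _)) // lerD2l.
Qed.

Lemma Re_le_cmod z : `|complex.Re z| <= cmod z.
Proof.
case: z => a b; rewrite /cmod /= -sqrtr_sqr ler_wsqrtr //.
by rewrite lerDl sqr_ge0.
Qed.

Lemma Im_le_cmod z : `|complex.Im z| <= cmod z.
Proof.
case: z => a b; rewrite /cmod /= -sqrtr_sqr ler_wsqrtr //.
by rewrite lerDr sqr_ge0.
Qed.

Lemma cmod_le_ReIm z : cmod z <= `|complex.Re z| + `|complex.Im z|.
Proof.
case: z => a b; rewrite /cmod /= -[leRHS]ger0_norm ?addr_ge0 //.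
rewrite -[leRHS]sqrtr_sqr ler_wsqrtr // sqrrD !real_normK ?num_real //.
by rewrite lerD2r lerDl mulrn_wge0 // mulr_ge0.
Qed.

(** Neighbourhoods in the topology of R[i], in terms of the real modulus. *)
Lemma nbhs_cmod (z : C^o) (P : set C^o) :
  nbhs z P <-> exists2 d : R, 0 < d & forall w, cmod (w - z) < d -> P w.
Proof.
split.
  move=> /nbhs_ballP[e /= e0 He]; exists (complex.Re e).
    by move: e0; rewrite ltcE => /andP[].
  move=> w wd; apply: He; rewrite /ball /= normE cmodB.
  have -> : e = (complex.Re e)%:C by rewrite RRe_real // gtr0_real.
  by rewrite ltcR.
move=> [d d0 Hd]; apply/nbhs_ballP; exists d%:C => /=.
  by rewrite ltcR.
by move=> w; rewrite /ball /= normE ltcR cmodB => /Hd.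
Qed.

Lemma cvg_cmod (u : nat -> C^o) (l : C^o) :
  u @ \oo --> l <->
  forall e : R, 0 < e -> exists m, forall n, (m <= n)%N -> cmod (u n - l) < e.
Proof.
split.
  move=> ul e e0; have : nbhs l [set w | cmod (w - l) < e].
    by apply/nbhs_cmod; exists e.
  by move=> /ul[m _ Hm]; exists m => n mn; exact: Hm.
move=> H P /nbhs_cmod[d d0 Hd]; have [m Hm] := H _ d0.
by exists m => // n /= mn; apply: Hd; exact: Hm.
Qed.
End ComplexNorm.

(** * Continuity and power series expansions *)

Section Expansions.
Variable R : realType.
Local Notation C := (R[i]).
Implicit Types (x y z w : C) (F G : C -> C).

Lemma geo_lt (q D e : R) : 0 <= q -> q < 1 -> 0 <= D -> 0 < e ->
  exists m, forall n, (m <= n)%N -> D * q ^+ n < e.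
Proof.
move=> q0 q1 D0 e0.
have : (GRing.exp q) @ \oo --> (0 : R) by apply: cvg_expr; rewrite ger0_norm.
have e1 : 0 < e / (D + 1) by rewrite divr_gt0 // ltr_wpDl.
move=> /cvgrPdist_lt /(_ _ e1)[m _ Hm]; exists m => n mn.
have := Hm n mn; rewrite /= sub0r normrN ger0_norm ?exprn_ge0 // => H.
have D1 : 0 < D + 1 by lra.
apply: (@le_lt_trans _ _ ((D + 1) * q ^+ n)).
  by rewrite ler_wpM2r ?exprn_ge0 // lerDl.
by rewrite mulrC -ltr_pdivlMr.
Qed.

(** Letting a geometric error term tend to 0 in an inequality. *)
Lemma le_geo_lim (q D u v : R) : 0 <= q -> q < 1 -> 0 <= D ->
  (forall n, u <= v + D * q ^+ n) -> u <= v.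
Proof.
move=> q0 q1 D0 H; rewrite leNgt; apply/negP => vu.
have e0 : 0 < u - v by rewrite subr_gt0.
have [m Hm] := geo_lt q0 q1 D0 e0.
have := Hm m (leqnn m); have := H m; lra.
Qed.

Lemma geo_sum_le (q : R) n m : 0 <= q -> q <= 2^-1 ->
  \sum_(n <= k < m) q ^+ k <= 2 * q ^+ n.
Proof.
move=> q0 q2; have [mn|/ltnW nm] := leqP m n.
  by rewrite big_geq // mulr_ge0 // exprn_ge0.
rewrite -(subnK nm); move: (m - n)%N => d; elim: d n {nm} => [|d IH] n.
  by rewrite add0n big_geq // mulr_ge0 // exprn_ge0.
rewrite big_ltn; last by rewrite addSn ltnS leq_addl.
rewrite addSnnS (le_trans (lerD (lexx _) (IH n.+1))) // exprS.
have : 0 <= q ^+ n by rewrite exprn_ge0.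
nra.
Qed.

(** Continuity at a point, in terms of the real modulus. *)
Definition ccont F z := forall e : R, 0 < e ->
  exists2 d : R, 0 < d & forall w, cmod (w - z) < d -> cmod (F w - F z) < e.

Lemma ccont_cst c z : ccont (fun=> c) z.
Proof. by move=> e e0; exists 1 => // w _; rewrite subrr cmod0. Qed.

Lemma ccont_id z : ccont id z.
Proof. by move=> e e0; exists e. Qed.

(* Only the values near the point matter. *)
Lemma ccont_near F G z (d : R) : 0 < d ->
  (forall w, cmod (w - z) < d -> F w = G w) -> ccont F z -> ccont G z.
Proof.
move=> d0 FG cF e e0; have [d' d'0 H] := cF e e0.
exists (Num.min d d'); first by rewrite lt_min d0.
move=> w; rewrite lt_min => /andP[w1 w2]; rewrite -FG // -FG ?subrr ?cmod0 //.
exact: H.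
Qed.

Lemma ccontD F G z : ccont F z -> ccont G z -> ccont (fun w => F w + G w) z.
Proof.
move=> cF cG e e0; have e2 : 0 < e / 2 by rewrite divr_gt0.
have [d d0 H] := cF _ e2; have [d' d'0 H'] := cG _ e2.
exists (Num.min d d'); first by rewrite lt_min d0.
move=> w; rewrite lt_min => /andP[/H w1 /H' w2].
rewrite (_ : _ - _ = (F w - F z) + (G w - G z)); last by ring.
by apply: le_lt_trans (cmodD _ _) _; lra.
Qed.

Lemma ccontM F G z : ccont F z -> ccont G z -> ccont (fun w => F w * G w) z.
Proof.
move=> cF cG e e0.
have F0 := cmod_ge0 (F z); have G0 := cmod_ge0 (G z).
have F1 : 0 < cmod (F z) + 1 by lra.
have G1 : 0 < cmod (G z) + 1 by lra.
have e1 : 0 < Num.min 1 (e / 2 / (cmod (G z) + 1)).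
  by rewrite lt_min ltr01 !divr_gt0.
have e2 : 0 < e / 2 / (cmod (F z) + 1) by rewrite !divr_gt0.
have [d d0 H] := cF _ e1; have [d' d'0 H'] := cG _ e2.
exists (Num.min d d'); first by rewrite lt_min d0.
move=> w; rewrite lt_min => /andP[/H w1 /H' w2].
move: w1; rewrite lt_min => /andP[w0 w1].
rewrite (_ : _ - _ = F w * (G w - G z) + (F w - F z) * G z); last by ring.
apply: le_lt_trans (cmodD _ _) _; rewrite !cmodM.
have Fw : cmod (F w) <= cmod (F z) + 1.
  rewrite -(subrK (F z) (F w)) (le_trans (cmodD _ _)) // addrC lerD2l; exact: ltW.
move: w2 w1; rewrite !ltr_pdivlMr // => w2 w1.
have := cmod_ge0 (G w - G z); have := cmod_ge0 (F w - F z).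
have := cmod_ge0 (F w).
set a := cmod (F w); set b := cmod (G w - G z); set c := cmod (F w - F z) in w1 *.
move=> a0 c0 b0; move: w2 w1 Fw; rewrite -/a -/b -/c.
nra.
Qed.

Lemma ccontV F z : F z != 0 -> ccont F z -> ccont (fun w => (F w)^-1) z.
Proof.
rewrite -cmod_gt0 => Fz cF e e0.
set m := cmod (F z) in Fz *.
have e1 : 0 < Num.min (m / 2) (e * m ^+ 2 / 2).
  by rewrite lt_min !divr_gt0 // mulr_gt0 // exprn_gt0.
have [d d0 H] := cF _ e1; exists d => // w /H; rewrite lt_min => /andP[w0 w1].
have mw : m / 2 < cmod (F w).
  have : m <= cmod (F w) + cmod (F w - F z).
    by rewrite cmodB (le_trans _ (cmodD _ _)) // addrC subrK.
  lra.
have Fw0 : F w != 0 by rewrite -cmod_gt0; lra.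
have Fz0 : F z != 0 by rewrite -cmod_gt0.
rewrite (_ : _ - _ = (F z - F w) / (F w * F z)); last by field; rewrite Fz0 Fw0.
rewrite cmodM cmodV cmodM cmodB -/m ltr_pdivrMr ?mulr_gt0 //; last by lra.
by apply: lt_trans w1 _; rewrite -mulrA ltr_pM2l // expr2 mulrAC ltr_pM2r //.
Qed.

Lemma ccontB F G z : ccont F z -> ccont G z -> ccont (fun w => F w - G w) z.
Proof.
move=> cF cG; apply: ccontD => // e e0; have [d d0 H] := cG e e0.
by exists d => // w /H; rewrite -opprD cmodN.
Qed.

Lemma ccontX F n z : ccont F z -> ccont (fun w => F w ^+ n) z.
Proof.
move=> cF; elim: n => [|n IH].
  by apply: (@ccont_near (fun=> 1) _ _ 1) => //; exact: ccont_cst.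
apply: (@ccont_near (fun w => F w * F w ^+ n) _ _ 1) => //.
  by move=> w _; rewrite exprS.
exact: ccontM.
Qed.

Lemma ccont_sum (I : Type) (r : seq I) (F : I -> C -> C) z :
  (forall i, ccont (F i) z) -> ccont (fun w => \sum_(i <- r) F i w) z.
Proof.
move=> cF; elim: r => [|i r IH].
  apply: (@ccont_near (fun=> 0) _ _ 1) => //; last exact: ccont_cst.
  by move=> w _; rewrite big_nil.
apply: (@ccont_near (fun w => F i w + \sum_(i <- r) F i w) _ _ 1) => //.
  by move=> w _; rewrite big_cons.
exact: ccontD.
Qed.

Lemma ccont_horner (p : {poly C}) z : ccont (horner p) z.
Proof.
apply: (@ccont_near (fun w => \sum_(i < size p) p`_i * w ^+ i) _ _ 1) => //.
  by move=> w _; rewrite horner_coef.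
apply: ccont_sum => i; apply: ccontM; first exact: ccont_cst.
by apply: ccontX; exact: ccont_id.
Qed.

Lemma ccont_sub w z : ccont (fun z => z - w) z.
Proof. by apply: ccontB; [exact: ccont_id|exact: ccont_cst]. Qed.

(* A bound that holds near a point, except perhaps at the point, passes to it. *)
Lemma ccont_le F w (d E : R) : 0 < d -> ccont F w ->
  (forall z, z != w -> cmod (z - w) < d -> cmod (F z) <= E) -> cmod (F w) <= E.
Proof.
move=> d0 cF H; rewrite leNgt; apply/negP => EF.
have e0 : 0 < cmod (F w) - E by rewrite subr_gt0.
have [d' d'0 H'] := cF _ e0.
pose t : R := Num.min d d' / 2.
have t0 : 0 < t by rewrite divr_gt0 // lt_min d0.
have cw : cmod (w + t%:C - w) = t by rewrite addrAC subrr add0r cmod_real // ltW.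
have td : t < d by have := ge_min d d d'; rewrite lexx /= /t => ?; rewrite /t in t0; lra.
have td' : t < d' by have := ge_min d' d d'; rewrite lexx orbT /= /t => ?; rewrite /t in t0; lra.
have zw : w + t%:C != w by rewrite -subr_eq0 -cmod_eq0 cw gt_eqF.
have := H _ zw; rewrite cw => /(_ td) h1.
have := H' (w + t%:C); rewrite cw => /(_ td') h2.
have : cmod (F w) <= cmod (F (w + t%:C)) + cmod (F (w + t%:C) - F w).
  by rewrite (cmodB (F _)) (le_trans _ (cmodD _ _)) // addrC subrK.
lra.
Qed.

(** The function g is the sum, in the disc of centre w0 and radius r, of the
    power series with coefficients a, in the following quantitative sense: the
    n-th remainder is at most M q^n at distance q r from w0. At q = 1, on the
    boundary circle, the remainders are only bounded. *)
Definition has_expansion (g : C -> C) (w0 : C) (a : nat -> C) (r M : R) :=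
  0 < r /\ forall z, cmod (z - w0) <= r -> forall n,
    cmod (g z - \sum_(k < n) a k * (z - w0) ^+ k) <= M * (cmod (z - w0) / r) ^+ n.

Section Local.
Variables (g : C -> C) (w0 : C) (a : nat -> C) (r M : R).
Hypothesis hg : has_expansion g w0 a r M.

Let r0 : 0 < r. Proof. by case: hg. Qed.

Lemma expansion_bound z : cmod (z - w0) <= r -> cmod (g z) <= M.
Proof.
by case: hg => _ H /H /(_ 0%N); rewrite big_ord0 subr0 expr0 mulr1.
Qed.

Lemma expansion_M_ge0 : 0 <= M.
Proof.
apply: le_trans (cmod_ge0 (g w0)) _; apply: expansion_bound.
by rewrite subrr cmod0 ltW.
Qed.

(** Cauchy's estimates, up to a factor 2: the n-th term is the difference of two
    consecutive remainders. *)
Lemma expansion_coef n : cmod (a n) * r ^+ n <= 2 * M.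
Proof.
case: hg => _ H; pose z := w0 + r%:C.
have cz : cmod (z - w0) = r by rewrite /z addrAC subrr add0r cmod_real // ltW.
have h1 := H z _ n; have h2 := H z _ n.+1; move: h1 h2.
rewrite cz divff ?gt_eqF // !expr1n !mulr1 lexx => /(_ isT) h1 /(_ isT).
rewrite big_ord_recr /= => h2.
rewrite -[X in _ * X ^+ _]cz -cmodX -cmodM.
set s := \sum_(k < n) _ in h1 h2; set t := a n * _ in h2 *.
rewrite (_ : t = (g z - s) - (g z - (s + t))); last by ring.
by apply: le_trans (cmodBD _ _) _; lra.
Qed.

Lemma expansion_coef0 : a 0%N = g w0.
Proof.
case: hg => _ /(_ w0); rewrite subrr cmod0 mul0r => /(_ (ltW r0) 1%N).
rewrite big_ord1 expr0 mulr1 expr1 mulr0 => H.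
apply/esym/eqP; rewrite -subr_eq0 -cmod_eq0 eq_le H.
exact: cmod_ge0.
Qed.

(** Uniqueness of the expansion of the function 0. *)
Lemma expansion_coef_eq0 : (forall z, cmod (z - w0) <= r -> g z = 0) ->
  forall n, a n = 0.
Proof.
move=> g0; elim/ltn_ind => n IH; case: hg => _ H.
apply/eqP; rewrite -cmod_eq0 eq_le cmod_ge0 andbT.
have q0 : (0 : R) <= 2^-1 by rewrite invr_ge0.
have q1 : (2^-1 : R) < 1 by lra.
have D0 : 0 <= M / r ^+ n by rewrite divr_ge0 ?expansion_M_ge0 // exprn_ge0 // ltW.
(* The first n coefficients vanish, so up to sign the remainder of order n + 1 is
   a_n Z^n; compare at distance 2^-m r from the centre. *)
apply: (le_geo_lim q0 q1 D0) => m; rewrite add0r.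
have s0 : 0 < (2^-1 : R) ^+ m by rewrite exprn_gt0 // invr_gt0.
set s := _ ^+ m in s0 *.
have s1 : s <= 1 by rewrite exprn_ile1 //; lra.
pose z := w0 + (s * r)%:C.
have cz : cmod (z - w0) = s * r.
  by rewrite /z addrAC subrr add0r cmod_real // mulr_ge0 // ltW.
have zr : cmod (z - w0) <= r by rewrite cz ler_piMl // ltW.
have := H z zr n.+1; rewrite g0 // sub0r cmodN big_ord_recr /= big1 ?add0r; last first.
  by move=> i _; rewrite IH ?mul0r.
rewrite cmodM cmodX cz mulfK ?gt_eqF // exprMn exprSr.
rewrite (_ : M / r ^+ n * s = M * s / r ^+ n); last by ring.
rewrite ler_pdivlMr ?exprn_gt0 // => h.
have sn : 0 < s ^+ n by rewrite exprn_gt0.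
by rewrite -(ler_pM2l sn) mulrCA (le_trans h) // mulrCA.
Qed.

Lemma expansion_lipschitz z : cmod (z - w0) <= r ->
  cmod (g z - g w0) <= M / r * cmod (z - w0).
Proof.
case: hg => _ H zr; have := H z zr 1%N.
rewrite big_ord1 expr0 mulr1 expr1 expansion_coef0 => h.
by apply: le_trans h _; rewrite mulrCA mulrC.
Qed.

Lemma expansion_ccont : ccont g w0.
Proof.
move=> e e0; have M0 := expansion_M_ge0.
have c0 : 0 < M / r + 1 by rewrite ltr_wpDl // divr_ge0 // ltW.
exists (Num.min r (e / (M / r + 1))); first by rewrite lt_min r0 divr_gt0.
move=> z; rewrite lt_min => /andP[zr]; rewrite ltr_pdivlMr // => ze.
apply: le_lt_trans (expansion_lipschitz (ltW zr)) _.
by apply: le_lt_trans ze; rewrite mulrC ler_wpM2l ?cmod_ge0 // lerDl.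
Qed.

End Local.

(** A power series converging to f near a point expands f there: its terms at a
    nearby point are bounded, so it is dominated by a geometric series on a
    smaller disc. *)
Lemma analytic_expansion (Omega : set C^o) (f : C -> C) z0 :
  analytic_on Omega f -> Omega z0 -> exists a r M, has_expansion f z0 a r M.
Proof.
move=> /[apply] -[a /nbhs_cmod[d d0 Hd]].
pose z1 := z0 + (d / 2)%:C.
have cz1 : cmod (z1 - z0) = d / 2.
  by rewrite /z1 addrAC subrr add0r cmod_real // divr_ge0 // ltW.
have /cvg_cmod s1 := Hd z1 (ltac:(rewrite cz1; lra)).
have [m Hm] := s1 1 ltr01.
set t := fun k => cmod (a k) * (d / 2) ^+ k.
have tE k : t k = cmod (a k * (z1 - z0) ^+ k) by rewrite cmodM cmodX cz1.
pose M0 := 2 + \sum_(k < m) t k.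
have t_ge0 k : 0 <= t k by rewrite tE cmod_ge0.
have tM k : t k <= M0.
  have [km|mk] := ltnP k m.
    rewrite /M0 (bigD1 (Ordinal km)) //= addrCA lerDl addr_ge0 // sumr_ge0 //.
  have h1 := Hm k mk; have h2 := Hm k.+1 (leqW mk).
  move: h1 h2; rewrite /series /= !big_mkord big_ord_recr /= tE.
  set s := \sum_(_ < _) _; set u := a k * _ => h1 h2.
  rewrite (_ : u = (s + u - f z1) - (s - f z1)); last by ring.
  apply: le_trans (cmodBD _ _) _; rewrite /M0.
  have : 0 <= \sum_(k < m) t k by apply: sumr_ge0.
  lra.
have M0_ge0 : 0 <= M0 by apply: le_trans (tM 0%N).
exists a, (d / 4), (2 * M0); split; first by rewrite divr_gt0.
move=> z zd n.
have /cvg_cmod sz := Hd z (ltac:(lra)).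
set q := cmod (z - z0) / (d / 2).
have q0 : 0 <= q by rewrite divr_ge0 ?cmod_ge0 // divr_ge0 // ltW.
have q2 : q <= 2^-1.
  rewrite /q ler_pdivrMr; last lra.
  lra.
have qq : q <= cmod (z - z0) / (d / 4).
  rewrite /q ler_wpM2l ?cmod_ge0 // lef_pV2 ?posrE; lra.
apply: (@le_trans _ _ (2 * M0 * q ^+ n)); last first.
  by rewrite ler_wpM2l ?mulr_ge0 // lerXn2r ?nnegrE // (le_trans q0).
rewrite leNgt; apply/negP => lt.
have e0 : 0 < cmod (f z - \sum_(k < n) a k * (z - z0) ^+ k) - 2 * M0 * q ^+ n.
  by rewrite subr_gt0.
have [m' Hm'] := sz _ e0.
have := Hm' (maxn n m') (leq_maxr _ _).
have nN := leq_maxl n m'; set N := maxn n m' in nN *.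
rewrite /series /= (big_cat_nat (leq0n n) nN) //= big_mkord.
set s := \sum_(_ < _) _; set v := \sum_(_ <= _ < _) _.
have vM : cmod v <= 2 * M0 * q ^+ n.
  apply: le_trans (cmod_sum _ _ _) _.
  apply: (@le_trans _ _ (\sum_(n <= k < N) M0 * q ^+ k)).
    apply: ler_sum => k _; rewrite cmodM cmodX.
    rewrite (_ : q ^+ k = cmod (z - z0) ^+ k / (d / 2) ^+ k); last first.
      by rewrite exprMn exprVn.
    rewrite mulrA ler_pdivlMr ?exprn_gt0 //; last lra.
    by rewrite mulrAC ler_wpM2r ?exprn_ge0 ?cmod_ge0 // tM.
  rewrite -mulr_sumr; rewrite (mulrC 2) -mulrA.
  by rewrite ler_wpM2l // geo_sum_le.
move=> h.
have : cmod (f z - s) <= cmod v + cmod (s + v - f z).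
  rewrite (_ : f z - s = v - (s + v - f z)); last by ring.
  exact: cmodBD.
lra.
Qed.

Lemma expansion_cderiv (f : C -> C) z0 a r M :
  has_expansion f z0 a r M -> cderiv f z0 = a 1%N.
Proof.
move=> hf; have [r0 H] := hf; have M0 := expansion_M_ge0 hf.
rewrite /cderiv /derive1.
apply: (@cvg_lim C^o (@norm_hausdorff _ C^o) C^o).
move=> P /nbhs_cmod[d d0 Hd].
have c0 : 0 < M / r ^+ 2 + 1 by rewrite ltr_wpDl // divr_ge0 // exprn_ge0 // ltW.
have [e e0 He] : exists2 e : R, 0 < e & forall h : C, cmod h < e -> h != 0 ->
    cmod (h^-1 * (f (h + z0) - f z0) - a 1%N) < d.
  exists (Num.min r (d / (M / r ^+ 2 + 1))); first by rewrite lt_min r0 divr_gt0.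
  move=> h; rewrite lt_min => /andP[hr]; rewrite ltr_pdivlMr // => hd h0.
  have ch : h + z0 - z0 = h by rewrite addrK.
  have := H (h + z0); rewrite ch => /(_ (ltW hr) 2%N).
  rewrite big_ord_recr big_ord1 /= expr0 mulr1 expr1 (expansion_coef0 hf) => hh.
  have ch0 : 0 < cmod h by rewrite cmod_gt0.
  rewrite (_ : _ - _ = h^-1 * (f (h + z0) - (f z0 + a 1%N * h))); last by field.
  rewrite cmodM cmodV mulrC ltr_pdivrMr //; apply: le_lt_trans hh _.
  rewrite (_ : _ * _ = cmod h * (M / r ^+ 2) * cmod h); last first.
    by field; rewrite gt_eqF.
  rewrite ltr_pM2r //; apply: le_lt_trans hd.
  by rewrite ler_wpM2l ?cmod_ge0 // lerDl.
have : nbhs (0 : C^o) [set h : C^o | cmod h < e].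
  by apply/nbhs_cmod; exists e => // w; rewrite subr0.
move=> He0; change (nbhs (0 : C^o)
  (fun h : C^o => h != 0 -> P (h^-1 * (f (h + z0) - f z0)))).
apply: filterS He0 => h /= he h0.
exact/Hd/He.
Qed.

End Expansions.

(** * Integrals of complex functions on the unit interval *)

Section Integrals.
Variable R : realType.
Local Notation C := (R[i]).
Local Notation mu := (@lebesgue_measure R).

Lemma rcontP (u : R -> R) t : {for t, continuous u} <->
  forall e : R, 0 < e -> exists2 d : R, 0 < d &
    forall s, `|s - t| < d -> `|u s - u t| < e.
Proof.
split.
  move=> /cvgrPdist_lt H e e0; have /nbhs_ballP[d /= d0 Hd] := H e e0.
  exists d => // s sd; rewrite distrC; apply: Hd.
  by rewrite /ball /= distrC.
move=> H; apply/cvgrPdist_lt => e e0; have [d d0 Hd] := H e e0.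
apply/nbhs_ballP; exists d => // s; rewrite /ball /= => sd.
by rewrite distrC; apply: Hd; rewrite distrC.
Qed.

(** Continuity of a complex-valued function of a real variable. *)
Definition tcont (h : R -> C) t := forall e : R, 0 < e ->
  exists2 d : R, 0 < d & forall s, `|s - t| < d -> cmod (h s - h t) < e.

Lemma tcont_ReIm h t : tcont h t <->
  {for t, continuous (fun s => complex.Re (h s))} /\
  {for t, continuous (fun s => complex.Im (h s))}.
Proof.
split.
  move=> H; split; apply/rcontP => e e0; have [d d0 Hd] := H e e0;
    exists d => // s /Hd; apply: le_lt_trans.
    by apply: le_trans (Re_le_cmod _); case: (h s) (h t) => [a b] [c f].
  by apply: le_trans (Im_le_cmod _); case: (h s) (h t) => [a b] [c f].
move=> [/rcontP H1 /rcontP H2] e e0.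
have e2 : 0 < e / 2 by rewrite divr_gt0.
have [d d0 Hd] := H1 _ e2; have [d' d'0 Hd'] := H2 _ e2.
exists (Num.min d d'); first by rewrite lt_min d0.
move=> s; rewrite lt_min => /andP[/Hd h1 /Hd' h2].
apply: le_lt_trans (cmod_le_ReIm _) _.
by move: h1 h2; case: (h s) (h t) => [a b] [c f] /=; lra.
Qed.

Lemma tcont_comp (F : C -> C) (g : R -> C) t :
  ccont F (g t) -> tcont g t -> tcont (fun s => F (g s)) t.
Proof.
move=> cF cg e e0; have [d d0 Hd] := cF e e0; have [d' d'0 Hd'] := cg d d0.
by exists d' => // s /Hd' /Hd.
Qed.

Lemma tcontM h k t : tcont h t -> tcont k t -> tcont (fun s => h s * k s) t.
Proof.
move=> /tcont_ReIm[h1 h2] /tcont_ReIm[k1 k2]; apply/tcont_ReIm; split.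
  rewrite (_ : (fun s => _) = (fun s => complex.Re (h s) * complex.Re (k s) -
    complex.Im (h s) * complex.Im (k s))); last first.
    by apply/funext => s; case: (h s) (k s) => [a b] [c f].
  by apply: continuousB; apply: continuousM.
rewrite (_ : (fun s => _) = (fun s => complex.Re (h s) * complex.Im (k s) +
    complex.Im (h s) * complex.Re (k s))); last first.
  by apply/funext => s; case: (h s) (k s) => [a b] [c f].
by apply: continuousD; apply: continuousM.
Qed.

Lemma rcont_integrable (u : R -> R) :
  (forall t, 0 <= t <= 1 -> {for t, continuous u}) ->
  mu.-integrable `[0, 1] (EFin \o u).
Proof.
move=> H; apply: continuous_compact_integrable; first exact: segment_compact.
apply/subspace_continuousP => t /=; rewrite in_itv /= => t01.
apply: cvg_within_filter; exact: H.
Qed.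

Lemma rcont_bounded (u : R -> R) :
  (forall t, 0 <= t <= 1 -> {for t, continuous u}) ->
  exists B, forall t, 0 <= t <= 1 -> u t <= B.
Proof.
move=> H; have [|c _ Hc] := @EVT_max R u 0 1 ler01.
  apply/subspace_continuousP => t /=; rewrite in_itv /= => t01.
  apply: cvg_within_filter; exact: H.
by exists (u c) => t t01; apply: Hc; rewrite in_itv.
Qed.

Lemma tcont_bounded h : (forall t, 0 <= t <= 1 -> tcont h t) ->
  exists2 B, 0 <= B & forall t, 0 <= t <= 1 -> cmod (h t) <= B.
Proof.
move=> H; have [t t01|B HB] := @rcont_bounded (fun t => cmod (h t)).
  apply/rcontP => e e0; have [d d0 Hd] := H t t01 e e0.
  exists d => // s /Hd; apply: le_lt_trans; rewrite ler_norml.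
  have := cmodD (h s - h t) (h t); have := cmodD (h t - h s) (h s).
  by rewrite !subrK (cmodB (h t)); lra.
exists B; last exact: HB.
by apply: le_trans (HB 0 _); rewrite ?cmod_ge0 // lexx ler01.
Qed.

(** Continuity at every point of [0, 1], two-sided at the endpoints too: the
    arcs are defined and C^1 on the whole line. *)
Definition tcont01 h := forall t, 0 <= t <= 1 -> tcont h t.

Let int_Re h : tcont01 h ->
  mu.-integrable `[0, 1] (EFin \o (fun t => complex.Re (h t))).
Proof. by move=> H; apply: rcont_integrable => t /H /tcont_ReIm[]. Qed.

Let int_Im h : tcont01 h ->
  mu.-integrable `[0, 1] (EFin \o (fun t => complex.Im (h t))).
Proof. by move=> H; apply: rcont_integrable => t /H /tcont_ReIm[]. Qed.

Lemma cintegral01D h k : tcont01 h -> tcont01 k ->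
  cintegral01 (fun t => h t + k t) = cintegral01 h + cintegral01 k.
Proof.
move=> ch ck; rewrite /cintegral01.
rewrite [RHS](_ : _ = (\int[mu]_(t in `[0%R, 1%R]) complex.Re (h t) +
   \int[mu]_(t in `[0%R, 1%R]) complex.Re (k t)) +i*
   (\int[mu]_(t in `[0%R, 1%R]) complex.Im (h t) +
   \int[mu]_(t in `[0%R, 1%R]) complex.Im (k t))) //.
rewrite -!RintegralD //; do ?[exact: int_Re|exact: int_Im].
by congr (_ +i* _); apply: eq_Rintegral => t _; case: (h t) (k t) => [a b] [c f].
Qed.

Lemma cintegral01Z c h : tcont01 h ->
  cintegral01 (fun t => c * h t) = c * cintegral01 h.
Proof.
move=> ch; rewrite /cintegral01; case: c => a b.
have i1 := int_Re ch; have i2 := int_Im ch.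
have c1 t : 0 <= t <= 1 -> {for t, continuous (fun s => complex.Re (h s))}.
  by move=> /ch /tcont_ReIm[].
have c2 t : 0 <= t <= 1 -> {for t, continuous (fun s => complex.Im (h s))}.
  by move=> /ch /tcont_ReIm[].
have iZ (e : R) (u : R -> R) : (forall t, 0 <= t <= 1 -> {for t, continuous u}) ->
    mu.-integrable `[0, 1] (EFin \o (fun t => e * u t)).
  move=> cu; apply: rcont_integrable => t t01.
  by apply: continuousM; [exact: cst_continuous|exact: cu].
rewrite [RHS](_ : _ = (a * \int[mu]_(t in `[0%R, 1%R]) complex.Re (h t) -
   b * \int[mu]_(t in `[0%R, 1%R]) complex.Im (h t)) +i*
   (a * \int[mu]_(t in `[0%R, 1%R]) complex.Im (h t) +
   b * \int[mu]_(t in `[0%R, 1%R]) complex.Re (h t))) //.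
rewrite -!RintegralZl // -RintegralD //; do ?exact: iZ.
rewrite -RintegralB //; do ?exact: iZ.
rewrite -?RintegralZl //.
by congr (_ +i* _); apply: eq_Rintegral => t _; case: (h t) => [c f].
Qed.

Lemma eq_cintegral01 (h k : R -> C) : (forall t, 0 <= t <= 1 -> h t = k t) ->
  cintegral01 h = cintegral01 k.
Proof.
move=> hk; rewrite /cintegral01.
by congr (_ +i* _); apply: eq_Rintegral => t; rewrite inE /= in_itv /= => /hk ->.
Qed.

Let rint_cst (a : R) : \int[mu]_(t in `[0%R, 1%R]) a = a.
Proof.
rewrite Rintegral_cst //; set m := (X in fine X); have -> : m = 1%E.
  apply: etrans (lebesgue_measure_itv `[0%R, 1%R]) _.
  by rewrite /= lte01 /= oppr0 adde0.
by rewrite mulr1.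
Qed.

Lemma cintegral01_cst (w : C) : cintegral01 (fun=> w) = w.
Proof. by rewrite /cintegral01 !rint_cst; case: w. Qed.

Let rint_bound (u : R -> R) (M : R) :
  (forall t, 0 <= t <= 1 -> {for t, continuous u}) ->
  (forall t, 0 <= t <= 1 -> `|u t| <= M) ->
  `|\int[mu]_(t in `[0%R, 1%R]) u t| <= M.
Proof.
move=> cu uM; have iu := rcont_integrable cu.
have h1 : `|\int[mu]_(t in `[0%R, 1%R]) u t| <=
    \int[mu]_(t in `[0%R, 1%R]) `|u t| by exact: le_normr_Rintegral.
apply: le_trans h1 _.
rewrite -[leRHS]rint_cst.
apply: le_Rintegral => //.
- apply: rcont_integrable => t t01.
  exact: (continuous_comp (cu t t01) (@norm_continuous _ R _)).
- by apply: rcont_integrable => t _; exact: cst_continuous.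
Qed.

(** The factor 2 comes from bounding the real and imaginary parts separately. *)
Lemma cintegral01_bound h M : tcont01 h ->
  (forall t, 0 <= t <= 1 -> cmod (h t) <= M) ->
  cmod (cintegral01 h) <= 2 * M.
Proof.
move=> ch hM; apply: le_trans (cmod_le_ReIm _) _ => /=.
have := rint_bound (fun t t01 => ((tcont_ReIm _ _).1 (ch t t01)).1)
  (fun t t01 => le_trans (Re_le_cmod _) (hM t t01)).
have := rint_bound (fun t t01 => ((tcont_ReIm _ _).1 (ch t t01)).2)
  (fun t t01 => le_trans (Im_le_cmod _) (hM t t01)).
lra.
Qed.

(** Derivative of a complex-valued function of a real variable. *)
Definition tderiv (H : R -> C) t (l : C) :=
  is_derive t (1 : R) (fun s => complex.Re (H s)) (complex.Re l) /\
  is_derive t (1 : R) (fun s => complex.Im (H s)) (complex.Im l).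

Lemma tderiv_tcont H t l : tderiv H t l -> tcont H t.
Proof.
move=> [d1 d2]; apply/tcont_ReIm; split; apply: differentiable_continuous.
  by apply/derivable1_diffP; exact: @ex_derive.
by apply/derivable1_diffP; exact: @ex_derive.
Qed.

Lemma cintegral01_FTC H h : (forall t, 0 <= t <= 1 -> tderiv H t (h t)) ->
  tcont01 h -> cintegral01 h = H 1 - H 0.
Proof.
move=> dH ch.
suff FTC (U u : R -> R) : (forall t : R, 0 <= t <= 1 -> is_derive t (1 : R) U (u t)) ->
    (forall t, 0 <= t <= 1 -> {for t, continuous u}) ->
    \int[mu]_(t in `[0%R, 1%R]) u t = U 1 - U 0.
  have c1 := fun t t01 => (tcont_ReIm _ _).1 (ch t t01).
  rewrite /cintegral01.
  rewrite (FTC _ _ (fun t t01 => (dH t t01).1) (fun t t01 => (c1 t t01).1)).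
  rewrite (FTC _ _ (fun t t01 => (dH t t01).2) (fun t t01 => (c1 t t01).2)).
  by case: (H 1) (H 0) => [a b] [c d].
move=> dU cu.
have cU t : 0 <= t <= 1 -> {for t, continuous U}.
  move=> /dU dUt; apply: differentiable_continuous.
  by apply/derivable1_diffP; exact: @ex_derive.
rewrite /Rintegral (@continuous_FTC2 _ u U) //.
- apply/subspace_continuousP => t /=; rewrite in_itv /= => t01.
  by apply: cvg_within_filter; exact: cu.
- split.
  + move=> t; rewrite in_itv /= => /andP[t0 t1].
    have t01 : 0 <= t <= 1 by rewrite !ltW.
    by have := dU t t01 => dUt; exact: @ex_derive.
  + by apply: cvg_at_right_filter; apply: cU; rewrite lexx ler01.
  + by apply: cvg_at_left_filter; apply: cU; rewrite lexx ler01.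
- move=> t; rewrite in_itv /= => /andP[t0 t1].
  have t01 : 0 <= t <= 1 by rewrite !ltW.
  by have := dU t t01 => dUt; rewrite derive1E derive_val.
Qed.

Lemma tderivM H K t l m : tderiv H t l -> tderiv K t m ->
  tderiv (fun s => H s * K s) t (l * K t + H t * m).
Proof.
move=> [d1 d2] [d3 d4]; split.
  rewrite (_ : (fun s => _) = (fun s => complex.Re (H s)) * (fun s => complex.Re (K s)) -
    (fun s => complex.Im (H s)) * (fun s => complex.Im (K s))); last first.
    by apply/funext => s; rewrite /= !fctE; case: (H s) (K s) => [a b] [c f].
  apply: is_derive_eq (is_deriveB (is_deriveM d1 d3) (is_deriveM d2 d4)) _.
  move: l m (H t) (K t) {d1 d2 d3 d4} => [a b] [c d] [e f] [g h].
  by rewrite /= /GRing.scale /=; ring.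
rewrite (_ : (fun s => _) = (fun s => complex.Re (H s)) * (fun s => complex.Im (K s)) +
    (fun s => complex.Im (H s)) * (fun s => complex.Re (K s))); last first.
  by apply/funext => s; rewrite /= !fctE; case: (H s) (K s) => [a b] [c f].
apply: is_derive_eq (is_deriveD (is_deriveM d1 d4) (is_deriveM d2 d3)) _.
move: l m (H t) (K t) {d1 d2 d3 d4} => [a b] [c d] [e f] [g h].
by rewrite /= /GRing.scale /=; ring.
Qed.

Lemma tderivB_cst H t l c : tderiv H t l -> tderiv (fun s => H s - c) t l.
Proof.
move=> [d1 d2]; split.
  rewrite (_ : (fun s => _) = (fun s => complex.Re (H s)) - cst (complex.Re c)); last first.
    by apply/funext => s; rewrite /= !fctE; case: (H s) c => [a b] [e f].
  by apply: is_derive_eq; rewrite subr0.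
rewrite (_ : (fun s => _) = (fun s => complex.Im (H s)) - cst (complex.Im c)); last first.
  by apply/funext => s; rewrite /= !fctE; case: (H s) c => [a b] [e f].
by apply: is_derive_eq; rewrite subr0.
Qed.

Lemma tderivV (H : R -> C) t l : H t != 0 -> tderiv H t l ->
  tderiv (fun s => (H s)^-1) t (- ((H t)^-1 * (H t)^-1 * l)).
Proof.
move=> H0 [d1 d2].
pose n s := complex.Re (H s) ^+ 2 + complex.Im (H s) ^+ 2.
have n0 : n t != 0.
  move: H0; rewrite /n eq_complex; case: (H t) => a b /=; apply: contraNneq => /eqP.
  by rewrite paddr_eq0 ?sqr_ge0 // !sqrf_eq0.
have dn : is_derive t (1 : R) n (2 * (complex.Re (H t) * complex.Re l +
    complex.Im (H t) * complex.Im l)).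
  apply: is_derive_eq (is_deriveD (is_deriveM d1 d1) (is_deriveM d2 d2)) _.
  by rewrite /GRing.scale /=; ring.
have dv := is_deriveV n0 dn.
have invE (c d : R) : (c +i* d)^-1 =
  (c / (c ^+ 2 + d ^+ 2)) +i* (- (d / (c ^+ 2 + d ^+ 2))) by [].
split.
  rewrite (_ : (fun s => _) = (fun s => complex.Re (H s)) * (fun s => (n s)^-1)); last first.
    by apply/funext => s; rewrite /= !fctE /n; case: (H s).
  apply: is_derive_eq (is_deriveM d1 dv) _; move: n0; rewrite /n /GRing.scale /=.
  move: l (H t) {d1 d2 dn dv H0} => [a b] [c d]; rewrite invE /= => n0.
  by field.
rewrite (_ : (fun s => _) = (fun s => - complex.Im (H s)) * (fun s => (n s)^-1)); last first.
  by apply/funext => s; rewrite /= !fctE /n; case: (H s) => a b /=; rewrite mulNr.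
have dN : is_derive t (1 : R) (fun s => - complex.Im (H s)) (- complex.Im l).
  exact: is_deriveN d2.
apply: is_derive_eq (is_deriveM dN dv) _; move: n0; rewrite /n /GRing.scale /=.
move: l (H t) {d1 d2 dn dv dN H0} => [a b] [c d]; rewrite invE /= => n0.
by field.
Qed.

Lemma tderivX H t l n : tderiv H t l ->
  tderiv (fun s => H s ^+ n.+1) t (n.+1%:R * H t ^+ n * l).
Proof.
move=> dH; elim: n => [|n IH]; first by rewrite expr0 mulr1 mul1r.
rewrite (_ : (fun s => _) = (fun s => H s * H s ^+ n.+1)); last first.
  by apply/funext => s; rewrite exprS.
rewrite (_ : _ * l = l * H t ^+ n.+1 + H t * (n.+1%:R * H t ^+ n * l)); last first.
  have -> : n.+2%:R = 1 + n.+1%:R :> C by rewrite -natr1 addrC.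
  by rewrite exprS; ring.
exact: tderivM.
Qed.

End Integrals.

(** * Integrals along closed contours *)

Section ContourIntegrals.
Variable R : realType.
Local Notation C := (R[i]).

Lemma C1_real_deriv (u : R -> R) t : C1_real u -> is_derive t (1 : R) u (derive1 u t).
Proof. by move=> [du _]; rewrite derive1E; apply: derivableP; exact: du. Qed.

Lemma C1_arc_tderiv (g : R -> C) t : C1_arc g -> tderiv g t (arc_deriv g t).
Proof. by move=> [h1 h2]; split; exact: C1_real_deriv. Qed.

Lemma C1_arc_tcont (g : R -> C) t : C1_arc g -> tcont g t.
Proof. by move=> /(C1_arc_tderiv t) /tderiv_tcont. Qed.

Lemma arc_deriv_tcont (g : R -> C) t : C1_arc g -> tcont (arc_deriv g) t.
Proof. by move=> [[_ h1] [_ h2]]; apply/tcont_ReIm; split; [exact: h1|exact: h2]. Qed.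

Variable Gamma : seq (R -> C).
Hypothesis hGamma : closed_contour Gamma.

Local Notation K := (contour_image Gamma).
Local Notation I := (contour_integral Gamma).
Local Notation arc k := (nth (fun=> 0) Gamma k).

Let sz := size Gamma.

Let arcC1 k : (k < sz)%N -> C1_arc (arc k).
Proof. by case: hGamma => H _; exact: H. Qed.

Let arcK k t : (k < sz)%N -> 0 <= t <= 1 -> K (arc k t).
Proof. by move=> ks t01; exists k, t. Qed.

Lemma contour_integralE F : I F = \sum_(k < sz) arc_integral (arc k) F.
Proof. by rewrite /contour_integral (big_nth (fun=> 0)) big_mkord. Qed.

(** Continuity, as a function on the plane, at every point of the contour. *)
Definition ccontK (F : C -> C) := forall z, K z -> ccont F z.

Let integrand_cont F k : ccontK F -> (k < sz)%N ->
  tcont01 (fun t => F (arc k t) * arc_deriv (arc k) t).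
Proof.
move=> cF ks t t01; apply: tcontM; last exact/arc_deriv_tcont/arcC1.
by apply: tcont_comp; [exact/cF/arcK|exact/C1_arc_tcont/arcC1].
Qed.

Lemma eq_contour_integral F G : (forall z, K z -> F z = G z) -> I F = I G.
Proof.
move=> FG; rewrite !contour_integralE; apply: eq_bigr => k _.
by apply: eq_cintegral01 => t t01; rewrite FG //; exact: arcK.
Qed.

Lemma contour_integralD F G : ccontK F -> ccontK G ->
  I (fun z => F z + G z) = I F + I G.
Proof.
move=> cF cG; rewrite !contour_integralE -big_split /=; apply: eq_bigr => k _.
rewrite /arc_integral -cintegral01D; try exact: integrand_cont.
by apply: eq_cintegral01 => t _; rewrite mulrDl.
Qed.

Lemma contour_integralZ c F : ccontK F -> I (fun z => c * F z) = c * I F.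
Proof.
move=> cF; rewrite !contour_integralE mulr_sumr; apply: eq_bigr => k _.
rewrite /arc_integral -cintegral01Z; try exact: integrand_cont.
by apply: eq_cintegral01 => t _; rewrite mulrA.
Qed.

Lemma contour_integralB F G : ccontK F -> ccontK G ->
  I (fun z => F z - G z) = I F - I G.
Proof.
move=> cF cG; rewrite -mulN1r -contour_integralZ // -contour_integralD //.
  by apply: eq_contour_integral => z _; rewrite mulN1r.
by move=> z Kz; apply: ccontM; [exact: ccont_cst|exact: cG].
Qed.

Lemma contour_integral_sum (J : Type) (r : seq J) (F : J -> C -> C) :
  (forall i, ccontK (F i)) ->
  I (fun z => \sum_(i <- r) F i z) = \sum_(i <- r) I (F i).
Proof.
move=> cF; elim: r => [|i r IH].
  rewrite big_nil -[RHS](mul0r (I (fun=> 0))) -contour_integralZ; last first.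
    by move=> z _; exact: ccont_cst.
  by apply: eq_contour_integral => z _; rewrite big_nil mulr0.
rewrite big_cons -IH -contour_integralD //.
  by apply: eq_contour_integral => z _; rewrite big_cons.
by move=> z Kz; apply: ccont_sum => j; exact: cF.
Qed.

(** A continuous function is bounded on a contour. *)
Lemma contour_bounded F : ccontK F ->
  exists2 B : R, 0 <= B & forall z, K z -> cmod (F z) <= B.
Proof.
move=> cF.
have H m : (m <= sz)%N -> exists2 B : R, 0 <= B & forall k t, (k < m)%N ->
    0 <= t <= 1 -> cmod (F (arc k t)) <= B.
  elim: m => [_|m IH ms]; first by exists 0.
  have [B B0 HB] := IH (ltnW ms).
  have [|B' B'0 HB'] := @tcont_bounded _ (fun t => F (arc m t)).
    by move=> t t01; apply: tcont_comp; [exact/cF/arcK|exact/C1_arc_tcont/arcC1].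
  exists (B + B'); first by rewrite addr_ge0.
  move=> k t; rewrite ltnS leq_eqVlt => /orP[/eqP -> t01|km t01].
    by rewrite (le_trans (HB' t t01)) // lerDr.
  by rewrite (le_trans (HB k t km t01)) // lerDl.
have [B B0 HB] := H sz (leqnn _); exists B => // z [k [t [ks t01 ->]]].
exact: HB.
Qed.

(** The constant L plays the role of the length of the contour. *)
Lemma contour_integral_bound : exists2 L : R, 0 <= L & forall F M, ccontK F ->
  (forall z, K z -> cmod (F z) <= M) -> cmod (I F) <= L * M.
Proof.
have H m : (m <= sz)%N -> exists2 L : R, 0 <= L & forall F M, ccontK F ->
    (forall z, K z -> cmod (F z) <= M) ->
    cmod (\sum_(k < m) arc_integral (arc k) F) <= L * M.
  elim: m => [_|m IH ms].
    by exists 0 => // F M _ _; rewrite big_ord0 cmod0 mul0r.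
  have [L L0 HL] := IH (ltnW ms).
  have [|D D0 HD] := @tcont_bounded _ (arc_deriv (arc m)).
    by move=> t _; exact/arc_deriv_tcont/arcC1.
  exists (L + 2 * D); first by rewrite addr_ge0 // mulr_ge0.
  move=> F M cF FM; rewrite big_ord_recr /= mulrDl.
  apply: le_trans (cmodD _ _) _; apply: lerD; first exact: HL.
  rewrite -mulrA; apply: cintegral01_bound; first exact: integrand_cont.
  move=> t t01; rewrite cmodM mulrC.
  by apply: ler_pM; rewrite ?cmod_ge0 ?HD // FM //; exact: arcK.
have [L L0 HL] := H sz (leqnn _); exists L => // F M cF FM.
by rewrite contour_integralE; exact: HL.
Qed.

(* The sum of the increments of P along a closed chain of arcs is 0. *)
Let path_telescope (P : C -> C) (g : R -> C) (s : seq (R -> C)) (h : R -> C) :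
  path (fun g h : R -> C => g 1 == h 0) g (rcons s h) ->
  \sum_(k <- g :: s) (P (k 1) - P (k 0)) = P (h 0) - P (g 0).
Proof.
elim: s g => [|k s IH] g /=.
  by rewrite andbT big_seq1 => /eqP ->.
move=> /andP[/eqP gk /IH]; rewrite big_cons => ->; rewrite gk addrC.
by rewrite addrA subrK.
Qed.

(** The integral along a closed contour of a function that has a primitive
    there vanishes. *)
Lemma contour_integral_primitive (F P : C -> C) : ccontK F ->
  (forall k t, (k < sz)%N -> 0 <= t <= 1 ->
    tderiv (fun s => P (arc k s)) t (F (arc k t) * arc_deriv (arc k) t)) ->
  I F = 0.
Proof.
move=> cF dP; rewrite contour_integralE.
rewrite (eq_bigr (fun k : 'I_sz => P (arc k 1) - P (arc k 0))); last first.
  move=> k _; apply: (@cintegral01_FTC _ (fun s => P (arc k s))).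
    by move=> t t01; exact: dP.
  exact: integrand_cont.
rewrite -(big_mkord xpredT (fun k => P (arc k 1) - P (arc k 0))).
rewrite /sz -(big_nth _ xpredT (fun g : R -> C => P (g 1) - P (g 0))).
case: hGamma => _; case: (Gamma) => [|g s] /=; first by rewrite big_nil.
by move=> /(path_telescope P) ->; rewrite subrr.
Qed.

(** All the powers of z - c except the power -1 have a primitive. *)
Lemma contour_integral_pow c n : I (fun z => (z - c) ^+ n) = 0.
Proof.
have cX m : ccontK (fun z => (z - c) ^+ m).
  by move=> z _; apply: ccontX; exact: ccont_sub.
have n0 : (n.+1%:R : C) != 0 by rewrite pnatr_eq0.
apply: (mulfI n0); rewrite mulr0 -contour_integralZ //.
apply: (@contour_integral_primitive _ (fun z => (z - c) ^+ n.+1)).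
  by move=> z Kz; apply: ccontM; [exact: ccont_cst|exact: cX].
move=> k t ks t01.
by apply: tderivX; apply: tderivB_cst; exact/C1_arc_tderiv/arcC1.
Qed.

Lemma ccontK_inv c : ~ K c -> ccontK (fun z => (z - c)^-1).
Proof.
move=> Kc z Kz; apply: ccontV; last exact: ccont_sub.
by rewrite subr_eq0; apply/eqP => zc; apply: Kc; rewrite -zc.
Qed.

Lemma ccontK_invX c n : ~ K c -> ccontK (fun z => (z - c)^-1 ^+ n).
Proof. by move=> Kc z Kz; apply: ccontX; exact: ccontK_inv. Qed.

Lemma contour_integral_invpow c n : ~ K c -> I (fun z => (z - c)^-1 ^+ n.+2) = 0.
Proof.
move=> Kc.
have n0 : - (n.+1%:R : C) != 0 by rewrite oppr_eq0 pnatr_eq0.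
apply: (mulfI n0); rewrite mulr0 -contour_integralZ; last exact: ccontK_invX.
apply: (@contour_integral_primitive _ (fun z => (z - c)^-1 ^+ n.+1)).
  by move=> z Kz; apply: ccontM; [exact: ccont_cst|exact: ccontK_invX].
move=> k t ks t01.
have gc : arc k t - c != 0.
  rewrite subr_eq0; apply/eqP => gc; apply: Kc; rewrite -gc; exact: arcK.
have dg := tderivB_cst c (C1_arc_tderiv t (arcC1 ks)).
have := tderivX n (tderivV gc dg).
by congr (tderiv _ _ _); rewrite [in RHS]exprS [in RHS]exprS; ring.
Qed.

End ContourIntegrals.

(** * The maximum principle and Liouville's theorem *)

Section Liouville.
Variable R : realType.
Local Notation C := (R[i]).

(** Local maximum principle: if the modulus of g is maximal at the centre of a
    power series expansion, then g is constant on a disc. The first nonzero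
    coefficient a_k, k > 0, would give a point near the centre, in the direction
    of a k-th root of a_0 / a_k, where the modulus is larger. *)
Lemma expansion_max_const (g : C -> C) w0 a r M : has_expansion g w0 a r M ->
  (forall z, cmod (g z) <= cmod (g w0)) ->
  exists2 d : R, 0 < d & forall z, cmod (z - w0) < d -> g z = g w0.
Proof.
move=> hg gmax; have [r0 H] := hg; have M0 := expansion_M_ge0 hg.
have a0 := expansion_coef0 hg.
have [g0|g0] := eqVneq (g w0) 0.
  exists 1 => // z _; rewrite g0; apply/eqP; rewrite -cmod_eq0 eq_le cmod_ge0 andbT.
  by rewrite (le_trans (gmax z)) // g0 cmod0.
have ak k : a k.+1 = 0.
  elim/ltn_ind: k => k IH; apply/eqP/negPn/negP => ak0.
  pose c := k.+1.-root (a 0%N / a k.+1).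
  have ck : c ^+ k.+1 = a 0%N / a k.+1 by rewrite rootCK.
  have c0 : 0 < cmod c.
    rewrite cmod_gt0; apply/eqP => c0; move: ck; rewrite c0 expr0n /= => /esym/eqP.
    by rewrite mulf_eq0 invr_eq0 (negbTE ak0) orbF a0 (negbTE g0).
  have m0 : 0 < cmod (g w0) by rewrite cmod_gt0.
  (* At z = w0 + s c the first k + 2 terms add up to a_0 (1 + s^(k+1)), and the
     remainder is at most A s^(k+2), which is smaller once s is small. *)
  pose A := M * (cmod c / r) ^+ k.+2.
  have A0 : 0 <= A by rewrite mulr_ge0 // exprn_ge0 // divr_ge0 // ltW.
  pose s := Num.min (r / cmod c) (cmod (g w0) / (A + 1)).
  have A1 : 0 < A + 1 by lra.
  have s0 : 0 < s by rewrite lt_min !divr_gt0.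
  have s1 : s * cmod c <= r by rewrite -ler_pdivlMr // ge_min lexx.
  have s2 : s * (A + 1) <= cmod (g w0) by rewrite -ler_pdivlMr // ge_min lexx orbT.
  pose z := w0 + s%:C * c.
  have zw : z - w0 = s%:C * c by rewrite /z addrAC subrr add0r.
  have cz : cmod (z - w0) = s * cmod c by rewrite zw cmodM cmod_real // ltW.
  have := H z; rewrite cz => /(_ s1 k.+2).
  rewrite big_ord_recr big_ord_recl /= big1 => [|j _]; last by rewrite IH ?mul0r.
  rewrite expr0 mulr1 addr0 zw exprMn ck.
  rewrite (_ : a k.+1 * _ = a 0%N * s%:C ^+ k.+1); last by field.
  have -> : M * (s * cmod c / r) ^+ k.+2 = A * s * s ^+ k.+1.
    by rewrite /A -mulrA exprMn -mulrA -exprS; ring.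
  have sk : 0 < s ^+ k.+1 by rewrite exprn_gt0.
  have -> : a 0%N + a 0%N * s%:C ^+ k.+1 = a 0%N * (1 + s ^+ k.+1)%:C.
    by rewrite rmorphD rmorphXn /= rmorph1 mulrDr mulr1.
  set u := a 0%N * _ => h.
  have cu : cmod u = cmod (g w0) * (1 + s ^+ k.+1).
    by rewrite cmodM a0 cmod_real // addr_ge0 // ltW.
  have h1 : cmod u <= cmod (g z) + cmod (g z - u).
    by have := cmodBD (g z) (g z - u); rewrite subKr.
  have h2 := gmax z.
  have : cmod (g w0) * s ^+ k.+1 <= A * s * s ^+ k.+1 by move: h1; rewrite cu; lra.
  rewrite ler_pM2r // => h3.
  by move: s2; rewrite mulrDr mulr1; lra.
exists (r / 2); first by rewrite divr_gt0.
move=> z zr; apply/eqP; rewrite -subr_eq0 -cmod_eq0 eq_le cmod_ge0 andbT.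
have q0 : 0 <= cmod (z - w0) / r by rewrite divr_ge0 ?cmod_ge0 // ltW.
have q1 : cmod (z - w0) / r < 1 by rewrite ltr_pdivrMr // mul1r; lra.
apply: (le_geo_lim q0 q1 M0) => n; rewrite add0r.
have zr' : cmod (z - w0) <= r by lra.
have := H z zr' n.+1; rewrite big_ord_recl /= big1 => [|j _]; last by rewrite ak mul0r.
rewrite expr0 mulr1 addr0 a0 => /le_trans; apply.
by rewrite ler_wpM2l // exprS ler_piMl ?exprn_ge0 // ltW.
Qed.

(** A continuous function attains its maximum on a compact square. *)
Lemma square_max (u : C -> R) (B : R) : 0 <= B ->
  (forall z (e : R), 0 < e -> exists2 d : R, 0 < d &
     forall w, cmod (w - z) < d -> `|u w - u z| < e) ->
  exists z0 : C, [/\ `|complex.Re z0| <= B, `|complex.Im z0| <= B & forall z : C,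
    `|complex.Re z| <= B -> `|complex.Im z| <= B -> u z <= u z0].
Proof.
move=> B0 cu; pose Q : set (R * R) := `[- B, B]%classic `*` `[- B, B]%classic.
have Qc : compact Q by apply: compact_setX; exact: segment_compact.
have Q0 : Q !=set0 by exists (0, 0); split; rewrite /= in_itv /=; lra.
have cv : {within Q, continuous (fun p : R * R => u (p.1 +i* p.2))}.
  apply: continuous_subspaceT => -[x y]; apply/cvgrPdist_lt => e e0.
  have [d d0 Hd] := cu (x +i* y) e e0.
  have d2 : 0 < d / 2 by rewrite divr_gt0.
  exists (ball x (d / 2), ball y (d / 2)).
    by split; apply: nbhsx_ballx.
  move=> [x' y'] [] /=; rewrite /ball /= => h1 h2; rewrite distrC; apply: Hd.
  apply: le_lt_trans (cmod_le_ReIm _) _ => /=.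
  by rewrite distrC (distrC y'); lra.
have [[x y] /= xyQ Hmax] := compact_EVT_max Q0 Qc cv.
move: xyQ; rewrite inE /Q /= !in_itv /= => -[hx hy].
exists (x +i* y); split; rewrite ?ler_norml //=.
move=> [x' y'] /=; rewrite !ler_norml => hx' hy'.
by apply: (Hmax (x', y')); rewrite inE /Q; split; rewrite /= in_itv.
Qed.

(** Liouville's theorem for a function that tends to 0 at infinity: if it is not
    0, its modulus attains a positive maximum, and the local maximum principle
    carries the maximum arbitrarily far away. *)
Lemma expansion_vanish_infinity (H : C -> C) :
  (forall w0, exists a r M, has_expansion H w0 a r M) ->
  (forall e : R, 0 < e -> exists B : R, forall w, B < cmod w -> cmod (H w) <= e) ->
  forall w, H w = 0.
Proof.
move=> Hexp Hinf w1; apply/eqP/negPn/negP; rewrite -cmod_gt0 => m0.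
have m2 : 0 < cmod (H w1) / 2 by rewrite divr_gt0.
have [B HB] := Hinf _ m2.
have cH z (e : R) : 0 < e -> exists2 d : R, 0 < d &
    forall w, cmod (w - z) < d -> `|cmod (H w) - cmod (H z)| < e.
  move=> e0; have [a [r [M hH]]] := Hexp z.
  have [d d0 Hd] := expansion_ccont hH e0; exists d => // w /Hd.
  apply: le_lt_trans; rewrite ler_norml.
  have := cmodD (H w - H z) (H z); have := cmodD (H z - H w) (H w).
  by rewrite !subrK (cmodB (H z)); lra.
have inB z : cmod (H w1) <= cmod (H z) -> cmod z <= B.
  by move=> h; rewrite leNgt; apply/negP => /HB; lra.
have B0 : 0 <= B by apply: le_trans (cmod_ge0 w1) (inB w1 (lexx _)).
have [z0 [_ _ Hz0]] := square_max B0 cH.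
have sq z : cmod (H w1) <= cmod (H z) -> `|complex.Re z| <= B /\ `|complex.Im z| <= B.
  by move=> /inB h; split; apply: le_trans h; [exact: Re_le_cmod|exact: Im_le_cmod].
have w1z0 : cmod (H w1) <= cmod (H z0) by have [h1 h2] := sq w1 (lexx _); exact: Hz0.
have max0 z : cmod (H z) <= cmod (H z0).
  have [h|h] := leP (cmod (H z)) (cmod (H w1)); first exact: le_trans h w1z0.
  by have [h1 h2] := sq z (ltW h); exact: Hz0.
(* Let z0 + s1 be the last point to the right of z0, on the horizontal line
   through z0, where the modulus is maximal. The function is constant near it, so
   there are such points farther to the right. *)
pose S := [set s : R | cmod (H (z0 + s%:C)) = cmod (H z0)].
have S0 : S 0 by rewrite /S /= addr0.
have supS : has_sup S.
  split; first by exists 0.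
  exists (B - complex.Re z0) => s Ss.
  have [|h _] := sq (z0 + s%:C); first by rewrite Ss.
  have -> : s = complex.Re (z0 + s%:C) - complex.Re z0.
    by case: (z0) => x y /=; rewrite addrAC subrr add0r.
  by rewrite lerD2r (le_trans (ler_norm _)).
set s1 := sup S.
have shift (s : R) : cmod (z0 + s%:C - (z0 + s1%:C)) = `|s - s1|.
  rewrite opprD addrACA subrr add0r -rmorphB.
  by rewrite /= /cmod /= expr0n addr0 sqrtr_sqr.
have Ss1 : S s1.
  apply/eqP; rewrite eq_le max0 /= leNgt; apply/negP => lt.
  have e0 : 0 < cmod (H z0) - cmod (H (z0 + s1%:C)) by rewrite subr_gt0.
  have [d d0 Hd] := cH (z0 + s1%:C) _ e0.
  have [s Ss s1s] := sup_adherent d0 supS.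
  have ss1 : s <= s1 by apply: sup_upper_bound.
  have := Hd (z0 + s%:C); rewrite shift Ss => h.
  have : `|s - s1| < d by rewrite ltr_norml; move: s1s; rewrite -/s1; lra.
  by move=> /h /ltr_normlW; rewrite ltxx.
have [a [r [M hH]]] := Hexp (z0 + s1%:C).
have [|d d0 Hd] := expansion_max_const hH; first by move=> z; rewrite Ss1.
have : S (s1 + d / 2).
  rewrite /S /= Hd // shift (_ : s1 + d / 2 - s1 = d / 2); last by ring.
  by rewrite gtr0_norm; lra.
move=> /(sup_upper_bound supS); rewrite -/s1; lra.
Qed.

End Liouville.

(** * Difference quotients of a power series *)

Section DifferenceQuotients.
Variable R : realType.
Local Notation C := (R[i]).
Variables (g : C -> C) (w0 : C) (a : nat -> C) (r M : R).
Hypothesis hg : has_expansion g w0 a r M.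

(** The k-th iterated difference quotient of g at w0: g minus its Taylor
    polynomial of degree k - 1, divided by (z - w0) ^ k. At w0 its value is the
    coefficient a k, which makes it continuous there. *)
Fixpoint dquot (k : nat) (z : C) : C :=
  if k is k'.+1 then
    if z == w0 then a k'.+1 else (dquot k' z - a k') / (z - w0)
  else g z.

Let r0 : 0 < r. Proof. by case: hg. Qed.
Let M0 : 0 <= M. Proof. exact: expansion_M_ge0 hg. Qed.

Lemma dquot_center k : dquot k w0 = a k.
Proof. by case: k => [|k] /=; rewrite ?eqxx // (expansion_coef0 hg). Qed.

Lemma dquot_off k z : z != w0 -> dquot k.+1 z = (dquot k z - a k) / (z - w0).
Proof. by move=> /negbTE /= ->. Qed.

Arguments dquot : simpl never.

Lemma dquotS k z : dquot k.+1 z * (z - w0) = dquot k z - a k.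
Proof.
have [->|zw] := eqVneq z w0; first by rewrite !dquot_center !subrr mulr0.
by rewrite dquot_off // divfK // subr_eq0.
Qed.

Lemma dquot_taylor k z :
  dquot k z * (z - w0) ^+ k = g z - \sum_(j < k) a j * (z - w0) ^+ j.
Proof.
elim: k => [|k IH]; first by rewrite expr0 mulr1 big_ord0 subr0.
by rewrite exprS mulrA dquotS mulrBl IH big_ord_recr /= opprD addrA.
Qed.

Section Bound.
Variable B : R.
Hypothesis MB : 2 * M <= B.
Let rho := r / 2.
Let rho0 : 0 < rho. Proof. by rewrite divr_gt0. Qed.

Let rhoX n : rho ^+ n <= r ^+ n.
Proof.
apply: lerXn2r; rewrite ?nnegrE; [exact: ltW|exact: ltW|].
by rewrite /rho ler_pdivrMr // ler_pMr //; lra.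
Qed.

(** A bound on the disc of the expansion, and wherever g is bounded by B. Halving
    the radius absorbs the accumulation of the Taylor coefficients far from the
    centre. *)
Lemma dquot_bound k z : cmod (z - w0) <= r \/ cmod (g z) <= B ->
  cmod (dquot k z) * rho ^+ k <= B.
Proof.
have ck n : cmod (a n) * rho ^+ n <= 2 * M.
  apply: le_trans (expansion_coef hg n); by rewrite ler_wpM2l ?cmod_ge0 ?rhoX.
have [zr _|rz [|gB]] := leP (cmod (z - w0)) r; last first.
- elim: k => [|k IH]; first by rewrite expr0 mulr1.
  have : cmod (dquot k.+1 z) * cmod (z - w0) <= cmod (dquot k z) + cmod (a k).
    by rewrite -cmodM dquotS cmodBD.
  have h : cmod (dquot k.+1 z) * r <= cmod (dquot k.+1 z) * cmod (z - w0).
    by rewrite ler_wpM2l ?cmod_ge0 // ltW.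
  move=> /(le_trans h) {}h.
  have rk : 0 <= rho ^+ k by rewrite exprn_ge0 // ltW.
  have := ler_wpM2r rk h; have := ck k.
  rewrite exprS mulrA (_ : rho = r / 2) //; move: MB; lra.
- by [].
have [->|zw] := eqVneq z w0; first by rewrite dquot_center (le_trans (ck k)).
have z0 : 0 < cmod (z - w0) by rewrite cmod_gt0 subr_eq0.
have := (hg.2 z zr k); rewrite -dquot_taylor cmodM cmodX expr_div_n.
rewrite mulrCA mulrC ler_pM2l ?exprn_gt0 // => h.
have rk : 0 <= rho ^+ k by rewrite exprn_ge0 // ltW.
apply: le_trans (ler_wpM2r rk h) _; apply: (@le_trans _ _ M); last first.
  by have := M0; move: MB; lra.
by rewrite mulrAC ler_pdivrMr ?exprn_gt0 // ler_wpM2l.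
Qed.

End Bound.

(** The difference quotient of g between z and w, expanded in powers of w - w0. *)
Lemma dquot_remainder n z w : z != w ->
  (g z - g w) / (z - w) - \sum_(k < n) dquot k.+1 z * (w - w0) ^+ k =
  (dquot n z - dquot n w) * (w - w0) ^+ n / (z - w).
Proof.
rewrite -subr_eq0 => zw; elim: n => [|n IH].
  by rewrite big_ord0 subr0 expr0 mulr1.
rewrite big_ord_recr /= opprD addrA IH.
have hz := dquotS n z; have hw := dquotS n w.
apply: (mulIf zw); rewrite mulrBl !divfK // exprS.
have -> : dquot n z = dquot n.+1 z * (z - w0) + a n by rewrite hz subrK.
have -> : dquot n w = dquot n.+1 w * (w - w0) + a n by rewrite hw subrK.
by ring.
Qed.

Lemma dquot_ccont k z : ccont g z -> ccont (dquot k) z.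
Proof.
have [-> _|zw cg] := eqVneq z w0.
  move=> e e0.
  have B0 : 0 <= 2 * M / (r / 2) ^+ k.+1.
    by rewrite divr_ge0 ?mulr_ge0 // exprn_ge0 // divr_ge0 // ltW.
  set D := 2 * M / _ in B0; have D1 : 0 < D + 1 by lra.
  exists (Num.min r (e / (D + 1))); first by rewrite lt_min r0 divr_gt0.
  move=> w; rewrite lt_min => /andP[wr]; rewrite ltr_pdivlMr // => we.
  rewrite dquot_center -dquotS cmodM; apply: le_lt_trans we.
  rewrite mulrC ler_wpM2l ?cmod_ge0 //.
  have := dquot_bound (lexx (2 * M)) k.+1 (or_introl (ltW wr)).
  rewrite -ler_pdivlMr ?exprn_gt0 ?divr_gt0 // -/D; lra.
elim: k => [|k IH] //.
have zw0 : 0 < cmod (z - w0) by rewrite cmod_gt0 subr_eq0.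
apply: (@ccont_near _ (fun z => (dquot k z - a k) / (z - w0)) _ _ _ zw0).
  move=> w wz; rewrite dquot_off //; apply: contraTneq wz => ->.
  by rewrite cmodB ltxx.
apply: ccontM; first by apply: ccontB => //; exact: ccont_cst.
by apply: ccontV; [rewrite subr_eq0|exact: ccont_sub].
Qed.

(** The difference quotient (g z - g w) / (z - w), as a function of w, expands
    around w0 with coefficients dquot k.+1 z, uniformly in the points z where g is
    bounded by B. The remainder of order n + m, which tends to 0 with m for fixed
    z and w, is compared with that of order n. *)
Lemma dquot_expansion_bound B n z w : 2 * M <= B -> cmod (g z) <= B -> z != w ->
  cmod (w - w0) <= r / 4 ->
  cmod ((g z - g w) / (z - w) - \sum_(k < n) dquot k.+1 z * (w - w0) ^+ k) <=
  4 * B / r * (cmod (w - w0) / (r / 2)) ^+ n.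
Proof.
move=> MB gB zw wr.
have rho0 : 0 < r / 2 by rewrite divr_gt0.
have B0 : 0 <= B by apply: le_trans MB; rewrite mulr_ge0.
set q := cmod (w - w0) / (r / 2).
have q0 : 0 <= q by rewrite divr_ge0 ?cmod_ge0 // ltW.
have q2 : q <= 2^-1 by rewrite /q ler_pdivrMr //; lra.
have q1 : q < 1 by lra.
have wr' : cmod (w - w0) <= r by lra.
have zw0 : 0 < cmod (z - w) by rewrite cmod_gt0 subr_eq0.
have WE k : cmod (w - w0) ^+ k = q ^+ k * (r / 2) ^+ k.
  by rewrite -exprMn divfK // gt_eqF.
have Bz k := dquot_bound MB k (or_intror gB : cmod (z - w0) <= r \/ _).
have Bw k := dquot_bound MB k (or_introl wr' : _ \/ cmod (g w) <= B).
have D0 : 0 <= 2 * B / cmod (z - w) by rewrite divr_ge0 ?mulr_ge0 // ltW.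
apply: (le_geo_lim q0 q1 D0) => m.
have rem : cmod ((g z - g w) / (z - w) -
    \sum_(k < n + m) dquot k.+1 z * (w - w0) ^+ k) <= 2 * B / cmod (z - w) * q ^+ m.
  rewrite dquot_remainder // !cmodM cmodV cmodX WE.
  rewrite (_ : _ / _ = cmod (dquot (n + m) z - dquot (n + m) w) *
    (r / 2) ^+ (n + m) * q ^+ (n + m) / cmod (z - w)); last by ring.
  rewrite [leRHS]mulrAC ler_pM2r ?invr_gt0 //.
  have rN : 0 <= (r / 2) ^+ (n + m) by rewrite exprn_ge0 // ltW.
  apply: ler_pM; [by rewrite mulr_ge0 ?cmod_ge0|by rewrite exprn_ge0| |].
    apply: le_trans (ler_wpM2r rN (cmodBD _ _)) _.
    by rewrite mulrDl; have := Bz (n + m)%N; have := Bw (n + m)%N; lra.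
  by rewrite exprD ler_piMl ?exprn_ge0 // exprn_ile1 // ltW.
have -> : (g z - g w) / (z - w) - \sum_(k < n) dquot k.+1 z * (w - w0) ^+ k =
    ((g z - g w) / (z - w) - \sum_(k < n + m) dquot k.+1 z * (w - w0) ^+ k) +
    \sum_(n <= k < n + m) dquot k.+1 z * (w - w0) ^+ k.
  rewrite -!(big_mkord xpredT (fun k => dquot k.+1 z * (w - w0) ^+ k)).
  rewrite (big_cat_nat (leq0n n) (leq_addr m n)) /= opprD addrA.
  by rewrite subrK.
apply: le_trans (cmodD _ _) _; rewrite addrC; apply: lerD => //.
apply: le_trans (cmod_sum _ _ _) _.
apply: (@le_trans _ _ (\sum_(n <= k < n + m) B / (r / 2) * q ^+ k)).
  apply: ler_sum => k _; rewrite cmodM cmodX WE.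
  rewrite mulrCA mulrC ler_wpM2r ?exprn_ge0 // ler_pdivlMr // -mulrA -exprSr.
  exact: Bz.
rewrite -mulr_sumr (_ : 4 * B / r = B / (r / 2) * 2); last first.
  by field; rewrite gt_eqF.
rewrite -[leRHS]mulrA ler_wpM2l //; first by rewrite divr_ge0 // ltW.
exact: geo_sum_le.
Qed.

End DifferenceQuotients.

(** * Cauchy's theorem in its homology form *)

Section Cauchy.
Variable R : realType.

Let expr_div_le (x s t : R) n : 0 <= x -> 0 < s -> s <= t ->
  (x / t) ^+ n <= (x / s) ^+ n.
Proof.
move=> x0 s0 st; have t0 := lt_le_trans s0 st.
apply: lerXn2r; rewrite ?nnegrE; [by rewrite divr_ge0 // ltW..|].
by rewrite ler_wpM2l // lef_pV2.
Qed.

Local Notation C := (R[i]).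
Variable Gamma : seq (R -> C).
Hypothesis hGamma : closed_contour Gamma.
Local Notation K := (contour_image Gamma).
Local Notation I := (contour_integral Gamma).
Local Notation ccontK := (ccontK Gamma).

Let ccontK_cst c : ccontK (fun=> c).
Proof. by move=> z _; exact: ccont_cst. Qed.

Let ccontKM F G : ccontK F -> ccontK G -> ccontK (fun z => F z * G z).
Proof. by move=> cF cG z Kz; apply: ccontM; [exact: cF|exact: cG]. Qed.

(** The Cauchy transform of a continuous function along a contour is the sum of
    a power series near each point off the contour. *)
Lemma cauchy_transform_expansion F w0 : ccontK F -> ~ K w0 -> exists r M,
  has_expansion (fun w => I (fun z => F z * (z - w)^-1)) w0
    (fun k => I (fun z => F z * (z - w0)^-1 ^+ k.+1)) r M /\
  forall w, cmod (w - w0) <= r -> ~ K w.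
Proof.
move=> cF Kw0.
have [B B0 HB] := contour_bounded hGamma (ccontK_inv Kw0).
have [BF BF0 HBF] := contour_bounded hGamma cF.
have [L L0 HL] := contour_integral_bound hGamma.
have B1 : 0 < B + 1 by lra.
pose r := (B + 1)^-1 / 2.
have r0 : 0 < r by rewrite divr_gt0 // invr_gt0.
have far z : K z -> 2 * r <= cmod (z - w0).
  move=> Kz; rewrite /r mulrCA divff // mulr1.
  have zw : 0 < cmod (z - w0).
    by rewrite cmod_gt0 subr_eq0; apply/eqP => zw; apply: Kw0; rewrite -zw.
  rewrite -(invrK (cmod _)) lef_pV2 ?posrE ?invr_gt0 // -cmodV.
  by apply: le_trans (HB z Kz) _; lra.
have away z w : K z -> cmod (w - w0) <= r -> r <= cmod (z - w).
  move=> /far h1 h2; have : cmod (z - w0) <= cmod (z - w) + cmod (w - w0).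
    by rewrite -(subrKA w) cmodD.
  lra.
have offK w : cmod (w - w0) <= r -> ~ K w.
  by move=> wr Kw; have := away w w Kw wr; rewrite subrr cmod0; lra.
exists r, (L * (BF / r)); split=> //; split=> // w wr n.
have c1 m : ccontK (fun z => F z * (z - w0)^-1 ^+ m).
  by apply: ccontKM => //; exact: ccontK_invX.
have c2 : ccontK (fun z => F z * (z - w)^-1).
  by apply: ccontKM => //; apply: ccontK_inv; exact: offK.
have c3 : ccontK (fun z => F z * (z - w)^-1 * ((w - w0) * (z - w0)^-1) ^+ n).
  apply: ccontKM => // z Kz; apply: ccontX; apply: ccontM; first exact: ccont_cst.
  exact: (ccontK_inv Kw0).
have -> : I (fun z => F z * (z - w)^-1) -
    \sum_(k < n) I (fun z => F z * (z - w0)^-1 ^+ k.+1) * (w - w0) ^+ k =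
    I (fun z => F z * (z - w)^-1 * ((w - w0) * (z - w0)^-1) ^+ n).
  rewrite (eq_bigr (fun k : 'I_n =>
    I (fun z => (w - w0) ^+ k * (F z * (z - w0)^-1 ^+ k.+1)))); last first.
    by move=> k _; rewrite contour_integralZ // mulrC.
  rewrite -contour_integral_sum //; last first.
    by move=> k; apply: ccontKM.
  rewrite -contour_integralB //; last first.
    by move=> z Kz; apply: ccont_sum => k; apply: ccontM; [exact: ccont_cst|exact: c1].
  apply: eq_contour_integral => z Kz.
  have zw : z - w != 0 by rewrite -cmod_gt0; have := away z w Kz wr; lra.
  have zw0 : z - w0 != 0 by rewrite -cmod_gt0; have := far z Kz; lra.
  elim: n {c3} => [|n IH]; first by rewrite big_ord0 subr0 expr0 mulr1.
  rewrite big_ord_recr /= opprD addrA IH exprMn exprS [in RHS]exprS [in RHS]exprMn.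
  by field; rewrite zw zw0.
rewrite -mulrA; apply: HL => // z Kz.
rewrite !cmodM cmodX cmodM !cmodV -mulrA.
have h1 := far z Kz; have h2 := away z w Kz wr.
rewrite -mulrA; apply: ler_pM; rewrite ?cmod_ge0 ?HBF //.
  by rewrite mulr_ge0 ?invr_ge0 ?cmod_ge0 // exprn_ge0 // divr_ge0 // cmod_ge0.
apply: ler_pM; rewrite ?invr_ge0 ?cmod_ge0 ?exprn_ge0 ?divr_ge0 ?cmod_ge0 //.
  by rewrite lef_pV2 ?posrE //; lra.
by apply: expr_div_le; rewrite ?cmod_ge0 //; lra.
Qed.

(** The winding number is locally constant: in the expansion of the Cauchy
    transform of 1, all the coefficients but the first are integrals of functions
    that have a primitive. *)
Lemma winding_locally_constant w0 : ~ K w0 -> exists2 r : R, 0 < r &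
  forall w, cmod (w - w0) <= r ->
    I (fun z => (z - w)^-1) = I (fun z => (z - w0)^-1).
Proof.
move=> Kw0.
have [r [M [hx offK]]] := cauchy_transform_expansion (ccontK_cst 1) Kw0.
have [r0 H] := hx; have M0 := expansion_M_ge0 hx.
exists (r / 2); first by rewrite divr_gt0.
move=> w wr; apply/eqP; rewrite -subr_eq0 -cmod_eq0 eq_le cmod_ge0 andbT.
have q0 : 0 <= cmod (w - w0) / r by rewrite divr_ge0 ?cmod_ge0 // ltW.
have q1 : cmod (w - w0) / r < 1 by rewrite ltr_pdivrMr // mul1r; lra.
apply: (le_geo_lim q0 q1 M0) => n; rewrite add0r.
have wr' : cmod (w - w0) <= r by lra.
have := H w wr' n.+1; rewrite big_ord_recl /= big1; last first.
  move=> k _.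
  rewrite (_ : I _ = 0) ?mul0r // -[RHS](contour_integral_invpow hGamma k Kw0).
  by apply: eq_contour_integral => z _; rewrite mul1r.
rewrite expr0 mulr1 addr0.
rewrite (_ : I (fun z => 1 * (z - w)^-1) = I (fun z => (z - w)^-1)); last first.
  by apply: eq_contour_integral => z _; rewrite mul1r.
rewrite (_ : I (fun z => 1 * (z - w0)^-1 ^+ 1) = I (fun z => (z - w0)^-1)); last first.
  by apply: eq_contour_integral => z _; rewrite mul1r expr1.
move=> /le_trans; apply.
by rewrite ler_wpM2l // exprS ler_piMl ?exprn_ge0 // ltW.
Qed.

(** A closed contour does not wind around the points outside a disc that
    contains it: expand 1 / (z - w) in powers of z - c. *)
Lemma winding_outside_disc c rho w : (forall z, K z -> cmod (z - c) <= rho) ->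
  rho < cmod (w - c) -> I (fun z => (z - w)^-1) = 0.
Proof.
move=> Kc wc.
have [L L0 HL] := contour_integral_bound hGamma.
have far z : K z -> cmod (w - c) - rho <= cmod (z - w).
  move=> /Kc zc; have : cmod (w - c) <= cmod (w - z) + cmod (z - c).
    by rewrite -(subrKA z) cmodD.
  rewrite (cmodB w z); lra.
have Kw : ~ K w by move=> /far; rewrite subrr cmod0; lra.
have [rho_lt0|rho0] := ltP rho 0.
  rewrite (@eq_contour_integral _ _ _ (fun z => (z - c) ^+ 0)); last first.
    by move=> z /Kc h; have := cmod_ge0 (z - c) => ?; exfalso; lra.
  exact: contour_integral_pow.
have w0 : 0 < cmod (w - c) by lra.
have wc0 : w - c != 0 by rewrite -cmod_gt0.
set q := rho / cmod (w - c).
have q0 : 0 <= q by rewrite divr_ge0 // ltW.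
have q1 : q < 1 by rewrite ltr_pdivrMr // mul1r.
have D0 : 0 <= L / (cmod (w - c) - rho) by rewrite divr_ge0 // subr_ge0 ltW.
apply/eqP; rewrite -cmod_eq0 eq_le cmod_ge0 andbT.
apply: (le_geo_lim q0 q1 D0) => n; rewrite add0r.
have cX m : ccontK (fun z => (z - c) ^+ m).
  by move=> z _; apply: ccontX; exact: ccont_sub.
have -> : I (fun z => (z - w)^-1) =
    I (fun z => (z - w)^-1 * ((z - c) / (w - c)) ^+ n).
  apply/eqP; rewrite -subr_eq0 -contour_integralB //; first last.
  - apply: ccontKM; first exact: ccontK_inv.
    by move=> z Kz; apply: ccontX; apply: ccontM; [exact: ccont_sub|exact: ccont_cst].
  - exact: ccontK_inv.
  apply/eqP; rewrite (@eq_contour_integral _ _ _ (fun z =>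
    \sum_(k < n) - ((w - c)^-1 ^+ k.+1) * (z - c) ^+ k)); last first.
    move=> z Kz; have zw : z - w != 0.
      by rewrite -cmod_gt0; have := far z Kz; lra.
    elim: n => [|n IH]; first by rewrite big_ord0 expr0 mulr1 subrr.
    rewrite big_ord_recr /= -IH exprS [in RHS]exprS !exprMn.
    by field; rewrite zw wc0.
  rewrite contour_integral_sum //; last by move=> k; exact: ccontKM.
  by rewrite big1 // => k _; rewrite contour_integralZ // contour_integral_pow // mulr0.
rewrite -mulrA; apply: HL.
  apply: ccontKM; first exact: ccontK_inv.
  by move=> z Kz; apply: ccontX; apply: ccontM; [exact: ccont_sub|exact: ccont_cst].
move=> z Kz; rewrite cmodM cmodX cmodM !cmodV; have h := far z Kz.
apply: ler_pM; rewrite ?invr_ge0 ?cmod_ge0 ?exprn_ge0 ?divr_ge0 ?cmod_ge0 //.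
  by rewrite lef_pV2 ?posrE //; lra.
rewrite lerXn2r ?nnegrE ?divr_ge0 ?cmod_ge0 //.
by rewrite ler_wpM2r ?invr_ge0 ?cmod_ge0 // Kc.
Qed.

Section Dixon.
Variables (Omega : set C^o) (f : C -> C).
Hypothesis Omega_open : open Omega.
Hypothesis hf : analytic_on Omega f.
Hypothesis KO : K `<=` Omega.
Hypothesis Gamma0 : forall w, ~ Omega w -> I (fun z => (z - w)^-1) = 0.

(** Dixon's function. The two formulas agree at the points of Omega, off the
    contour, around which it does not wind. *)
Definition dixon (w : C) : C :=
  if `[< Omega w >] then
    I (fun z => if z == w then cderiv f w else (f z - f w) / (z - w))
  else I (fun z => f z * (z - w)^-1).

Lemma analytic_ccont z : Omega z -> ccont f z.
Proof. by move=> /(analytic_expansion hf)[a [r [M h]]]; exact: expansion_ccont h. Qed.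

Let cfK : ccontK f. Proof. by move=> z /KO; exact: analytic_ccont. Qed.

Let dquot1 w a r M z : has_expansion f w a r M ->
  (if z == w then cderiv f w else (f z - f w) / (z - w)) = dquot f w a 1 z.
Proof.
move=> h; have [->|zw] := eqVneq z w.
  by rewrite (dquot_center h) (expansion_cderiv h).
by rewrite dquot_off // /dquot (expansion_coef0 h).
Qed.

Lemma dixon_expansion_in w0 a r M : Omega w0 -> has_expansion f w0 a r M ->
  exists r' M', has_expansion dixon w0 (fun k => I (dquot f w0 a k.+1)) r' M'.
Proof.
move=> Ow0 h; have [r0 Hr] := h.
have M0 := expansion_M_ge0 h.
have /nbhs_cmod[d d0 Hd] : nbhs (w0 : C^o) Omega by exact: open_nbhs_nbhs.
have [B B0 HB] := contour_bounded hGamma cfK.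
have [L L0 HL] := contour_integral_bound hGamma.
pose B' := B + 2 * M.
pose r' := Num.min (d / 2) (r / 4).
have r'0 : 0 < r' by rewrite lt_min !divr_gt0.
have E0 : 0 <= 4 * B' / r.
  apply: divr_ge0; last exact: ltW.
  by apply: mulr_ge0 => //; apply: addr_ge0 => //; exact: mulr_ge0.
exists r', (L * (4 * B' / r)); split=> // w; rewrite le_min => /andP[wd wr] n.
have Ow : Omega w by apply: Hd; lra.
have [a' [s [M' h']]] := analytic_expansion hf Ow.
have cq k : ccontK (dquot f w0 a k) by move=> z Kz; apply: (dquot_ccont h); exact: cfK.
have cq' k : ccontK (dquot f w a' k) by move=> z Kz; apply: (dquot_ccont h'); exact: cfK.
have cS z : ccont f z ->
    ccont (fun z => \sum_(k < n) dquot f w0 a k.+1 z * (w - w0) ^+ k) z.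
  move=> cz; apply: ccont_sum => k.
  by apply: ccontM; [exact: (dquot_ccont h)|exact: ccont_cst].
have -> : dixon w = I (dquot f w a' 1).
  rewrite /dixon asboolT //; apply: eq_contour_integral => z _; exact: dquot1 h'.
have -> : \sum_(k < n) I (dquot f w0 a k.+1) * (w - w0) ^+ k =
    I (fun z => \sum_(k < n) dquot f w0 a k.+1 z * (w - w0) ^+ k).
  rewrite contour_integral_sum //; last by move=> k; exact: ccontKM.
  apply: eq_bigr => k _; rewrite mulrC -contour_integralZ //.
  by apply: eq_contour_integral => z _; rewrite mulrC.
rewrite -contour_integralB //; last by move=> z /cfK; exact: cS.
have bound z : cmod (f z) <= B' -> z != w ->
    cmod (dquot f w a' 1 z - \sum_(k < n) dquot f w0 a k.+1 z * (w - w0) ^+ k)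
    <= 4 * B' / r * (cmod (w - w0) / r') ^+ n.
  move=> fz zw; rewrite -(dquot1 z h') (negbTE zw).
  apply: le_trans (dquot_expansion_bound h n _ fz zw wr) _; first by rewrite /B'; lra.
  rewrite ler_wpM2l //; apply: expr_div_le; rewrite ?cmod_ge0 //.
  by have := ge_min (r / 4) (d / 2) (r / 4); rewrite lexx orbT -/r'; lra.
rewrite -mulrA; apply: HL => [|z Kz].
  by move=> z Kz; apply: ccontB; [exact: cq'|exact/cS/cfK].
have fz : cmod (f z) <= B' by apply: le_trans (HB z Kz) _; rewrite lerDl mulr_ge0.
have [->|zw] := eqVneq z w; last exact: bound.
(* On the diagonal, the bound follows by continuity from the points near w. *)
have wr4 : 0 < r / 2 by rewrite divr_gt0.
have cw := analytic_ccont Ow.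
apply: (@ccont_le _ (fun z => dquot f w a' 1 z -
  \sum_(k < n) dquot f w0 a k.+1 z * (w - w0) ^+ k) _ _ _ wr4).
  by apply: ccontB; [exact: (dquot_ccont h')|exact: cS].
move=> x xw xr; apply: bound => //.
apply: (@le_trans _ _ M); last by rewrite /B'; lra.
apply: (expansion_bound h); have : cmod (x - w0) <= cmod (x - w) + cmod (w - w0).
  by rewrite -(subrKA w) cmodD.
lra.
Qed.

Let dixon_off w : ~ K w -> I (fun z => (z - w)^-1) = 0 ->
  dixon w = I (fun z => f z * (z - w)^-1).
Proof.
move=> Kw Iw; rewrite /dixon; case: asboolP => // Ow.
have ci := ccontK_inv Kw.
rewrite (@eq_contour_integral _ _ _ (fun z => f z * (z - w)^-1 - f w * (z - w)^-1)).
  rewrite contour_integralB //; [|exact: ccontKM..].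
  by rewrite contour_integralZ // Iw mulr0 subr0.
move=> z Kz; case: eqP => [zw|_]; first by case: Kw; rewrite -zw.
by rewrite mulrBl.
Qed.

Lemma dixon_expansion w0 : exists a r M, has_expansion dixon w0 a r M.
Proof.
have [Ow0|Ow0] := pselect (Omega w0).
  have [a [r [M h]]] := analytic_expansion hf Ow0.
  have [r' [M' h']] := dixon_expansion_in Ow0 h.
  by exists (fun k => I (dquot f w0 a k.+1)), r', M'.
have Kw0 : ~ K w0 by move=> /KO.
have [r [M [hx offK]]] := cauchy_transform_expansion cfK Kw0.
have [r0 H] := hx.
have [r' r'0 Hr'] := winding_locally_constant Kw0.
pose s := Num.min r r'.
have s0 : 0 < s by rewrite lt_min r0.
have M0 := expansion_M_ge0 hx.
exists (fun k => I (fun z => f z * (z - w0)^-1 ^+ k.+1)), s, M; split=> // w.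
move=> ws n; have [wr wr'] : cmod (w - w0) <= r /\ cmod (w - w0) <= r'.
  by move: ws; rewrite le_min => /andP[].
rewrite dixon_off ?Hr' ?Gamma0 //; last exact: offK.
apply: le_trans (H w wr n) _.
rewrite ler_wpM2l //; apply: expr_div_le; rewrite ?cmod_ge0 //.
by rewrite ge_min lexx.
Qed.

Lemma dixon_infinity (e : R) : 0 < e ->
  exists B : R, forall w, B < cmod w -> cmod (dixon w) <= e.
Proof.
move=> e0; have [B B0 HB] := @contour_bounded _ _ hGamma id (fun z _ => @ccont_id _ z).
have [BF BF0 HBF] := contour_bounded hGamma cfK.
have [L L0 HL] := contour_integral_bound hGamma.
have LB : 0 <= L * BF by rewrite mulr_ge0.
exists (B + L * BF / e) => w wB.
have wB0 : B < cmod w by apply: le_lt_trans wB; rewrite lerDl divr_ge0 // ltW.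
have far z : K z -> cmod w - B <= cmod (z - w).
  move=> /HB zB; have := cmodD (w - z) z; rewrite subrK (cmodB w); move: zB => /=; lra.
have Kw : ~ K w by move=> /HB /=; lra.
rewrite dixon_off //; last first.
  by apply: (@winding_outside_disc 0 B) => [z|]; rewrite subr0 //; exact: HB.
apply: (@le_trans _ _ (L * (BF / (cmod w - B)))); last first.
  rewrite mulrA ler_pdivrMr ?subr_gt0 // -ler_pdivrMl //.
  by rewrite mulrC lerBrDl ltW.
apply: HL; first by apply: ccontKM => //; exact: ccontK_inv.
move=> z Kz; rewrite cmodM cmodV; apply: ler_pM; rewrite ?invr_ge0 ?cmod_ge0 ?HBF //.
by rewrite lef_pV2 ?posrE ?far ?subr_gt0 //; have := far z Kz; lra.
Qed.

Lemma dixon0 w : dixon w = 0.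
Proof. exact: expansion_vanish_infinity dixon_expansion dixon_infinity w. Qed.

(** Cauchy's theorem for the difference quotients of f: their integrals are the
    Taylor coefficients of Dixon's function, which is 0. *)
Lemma contour_integral_dquot w0 a r M k : Omega w0 -> has_expansion f w0 a r M ->
  I (dquot f w0 a k.+1) = 0.
Proof.
move=> Ow0 h; have [r' [M' h']] := dixon_expansion_in Ow0 h.
exact: (expansion_coef_eq0 h' (fun z _ => dixon0 z)).
Qed.

(** Cauchy's integral formula. *)
Lemma cauchy_formula w : Omega w -> ~ K w ->
  I (fun z => f z * (z - w)^-1) = f w * I (fun z => (z - w)^-1).
Proof.
move=> Ow Kw; have [a [r [M h]]] := analytic_expansion hf Ow.
have := contour_integral_dquot 0 Ow h.
have ci := ccontK_inv Kw.
rewrite (@eq_contour_integral _ _ _ (fun z => f z * (z - w)^-1 - f w * (z - w)^-1)).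
  rewrite contour_integralB //; [|exact: ccontKM..].
  by rewrite contour_integralZ // => /eqP; rewrite subr_eq0 => /eqP.
move=> z Kz; rewrite -(dquot1 z h); case: eqP => [zw|_]; first by case: Kw; rewrite -zw.
by rewrite mulrBl.
Qed.

(** Cauchy's integral formula for the derivative. *)
Lemma cauchy_formula_deriv w : Omega w -> ~ K w ->
  I (fun z => f z * (z - w)^-1 ^+ 2) = cderiv f w * I (fun z => (z - w)^-1).
Proof.
move=> Ow Kw; have [a [r [M h]]] := analytic_expansion hf Ow.
have := contour_integral_dquot 1 Ow h.
have ci := ccontK_inv Kw; have ci2 := @ccontK_invX _ Gamma w 2 Kw.
rewrite (@eq_contour_integral _ _ _ (fun z => (f z * (z - w)^-1 ^+ 2 -
  f w * (z - w)^-1 ^+ 2) - cderiv f w * (z - w)^-1)).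
  rewrite contour_integralB //; [|by move=> z Kz; apply: ccontB; exact: ccontKM|exact: ccontKM].
  rewrite contour_integralB //; [|exact: ccontKM..].
  rewrite !contour_integralZ // contour_integral_invpow // mulr0 subr0.
  by move=> /eqP; rewrite subr_eq0 => /eqP.
move=> z Kz; have zw : z != w by apply/eqP => zw; apply: Kw; rewrite -zw.
rewrite dquot_off // -(dquot1 z h) (negbTE zw) (expansion_cderiv h) mulrBl.
by rewrite mulrBl mulrBl expr2 !mulrA.
Qed.

End Dixon.
End Cauchy.

(** * Pairs of eigenvalues *)

Section EigenvaluePairs.
Variable F : fieldType.

Lemma prod_factor_pair n (lambda : 'I_n -> F) mu nu :
  (exists i j : 'I_n, [/\ i <> j, lambda i = mu & lambda j = nu]) <->
  ('X - mu%:P) * ('X - nu%:P) %| \prod_(i < n) ('X - (lambda i)%:P).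
Proof.
split=> [[i [j [ij <- <-]]]|dv].
  rewrite (bigD1 i) //= (bigD1 j) /=; last by apply/eqP => ji; apply: ij.
  by rewrite mulrA dvdp_mulr.
have prod_root (P : pred 'I_n) x : root (\prod_(i | P i) ('X - (lambda i)%:P)) x ->
    exists2 i, P i & lambda i = x.
  rewrite rootE horner_prod => /eqP /eqP; rewrite prodf_seq_eq0 => /hasP[i _ /andP[Pi]].
  by rewrite hornerXsubC subr_eq0 => /eqP xl; exists i.
have [i _ li] : exists2 i : 'I_n, true & lambda i = mu.
  by apply: prod_root; rewrite -dvdp_XsubCl (dvdp_trans _ dv) // dvdp_mulr.
move: dv; rewrite (bigD1 i) //= li dvdp_mul2l ?polyXsubC_eq0 // dvdp_XsubCl.
by move=> /prod_root[j ji lj]; exists i, j; split=> // ij; rewrite ij eqxx in ji.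
Qed.

Lemma char_poly_conj n (P A : 'M[F]_n) : P \in unitmx ->
  char_poly (P *m A *m invmx P) = char_poly A.
Proof.
move=> uP; rewrite /char_poly.
have -> : char_poly_mx (P *m A *m invmx P) =
    map_mx polyC P *m char_poly_mx A *m map_mx polyC (invmx P).
  rewrite /char_poly_mx mulmxBr mulmxBl !map_mxM; congr (_ - _).
  by rewrite scalar_mxC -mulmxA -map_mxM mulmxV // map_mx1 mulmx1.
rewrite !det_mulmx mulrAC -det_mulmx -map_mxM mulmxV // map_mx1 det1.
by rewrite mul1r.
Qed.

Lemma char_poly_lblock n1 n2 (A : 'M[F]_n1) C (D : 'M[F]_n2) :
  char_poly (block_mx A 0 C D) = char_poly A * char_poly D.
Proof.
rewrite /char_poly -(det_lblock _ (- map_mx polyC C)); congr (\det _).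
by rewrite /char_poly_mx map_block_mx map_mx0 scalar_mx_block opp_block_mx
  add_block_mx oppr0 !add0r.
Qed.

Lemma right_eigenvector n (A : 'M[F]_n) a : root (char_poly A) a <->
  exists2 v : 'cV_n, A *m v = a *: v & v != 0.
Proof.
have -> : char_poly A = char_poly A^T.
  rewrite /char_poly -det_tr; congr (\det _).
  by rewrite /char_poly_mx linearB /= tr_scalar_mx map_trmx.
rewrite -eigenvalue_root_char; split.
  move=> /eigenvalueP[v hv v0]; exists v^T; last by rewrite trmx_eq0.
  by apply: trmx_inj; rewrite trmx_mul trmxK hv linearZ /= trmxK.
move=> [v hv v0]; apply/eigenvalueP; exists v^T; last by rewrite trmx_eq0.
by rewrite -trmx_mul hv linearZ.
Qed.

(** Two eigenvalues with distinct indices, in terms of eigenvectors: a left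
    eigenvector u splits the factor 'X - mu off the characteristic polynomial,
    and the cofactor is the characteristic polynomial of A on the kernel of u. *)
Lemma eigenvalue_pair n (A : 'M[F]_n) (lambda : 'I_n -> F) mu nu :
  char_poly A = \prod_(i < n) ('X - (lambda i)%:P) ->
  (exists i j : 'I_n, [/\ i <> j, lambda i = mu & lambda j = nu]) <->
  exists (u : 'rV_n) (v : 'cV_n),
    [/\ u != 0, v != 0, u *m A = mu *: u, A *m v = nu *: v & u *m v = 0].
Proof.
move=> hA; apply: iff_trans (prod_factor_pair _ _ _) _; rewrite -hA {lambda hA}.
suff H (u : 'rV_n) : u != 0 -> u *m A = mu *: u ->
    ('X - mu%:P) * ('X - nu%:P) %| char_poly A <->
    exists v : 'cV_n, [/\ v != 0, A *m v = nu *: v & u *m v = 0].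
  split=> [dv|[u [v [u0 v0 uA Av uv]]]]; last by apply/(H u) => //; exists v.
  have /eigenvalueP[u uA u0] : eigenvalue A mu.
    by rewrite eigenvalue_root_char -dvdp_XsubCl (dvdp_trans _ dv) // dvdp_mulr.
  by have [v [v0 Av uv]] := (H u u0 uA).1 dv; exists u, v.
case: n A u => [|m] A u u0 uA; first by rewrite thinmx0 eqxx in u0.
(* In a basis of row vectors that starts with a multiple of u, the matrix of A is
   block triangular, with blocks mu and the matrix of A on the kernel of u. *)
pose P : 'M[F]_(1 + m) := row_ebase u; have uP : P \in unitmx by exact: row_ebase_unit.
pose c := col_ebase u 0 0.
pose e0 : 'rV[F]_(1 + m) := row_mx 1%:M 0.
have ru : \rank u = 1%N by rewrite rank_rV u0.
have uE : u = c *: (e0 *m P).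
  rewrite -[LHS]mulmx_ebase ru (mx11_scalar (col_ebase u)) -/c mul_scalar_mx.
  rewrite -scalemxAl; congr (c *: (_ *m _)).
  apply/rowP => j; rewrite /e0 !mxE; case: splitP => k jk; rewrite !mxE jk //.
  by rewrite (ord1 k).
have c0 : c != 0 by apply: contraNneq u0 => c0; rewrite uE c0 scale0r.
have e0P : e0 *m P = c^-1 *: u by rewrite uE scalerA mulVf // scale1r.
pose B : 'M[F]_(1 + m) := P *m A *m invmx P.
have e0B : e0 *m B = mu *: e0.
  rewrite /B !mulmxA e0P -!scalemxAl uA -scalemxAl scalerA mulrC -scalerA.
  by rewrite scalemxAl -e0P -mulmxA mulmxV // mulmx1.
have BE : B = block_mx mu%:M 0 (dlsubmx B) (drsubmx B).
  rewrite -[LHS]submxK; move: e0B; rewrite -{1}[B]submxK /e0 mul_row_block.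
  rewrite !mul1mx !mul0mx !addr0 scale_row_mx scaler0 scalemx1.
  by move=> /eq_row_mx[-> ->].
rewrite -(char_poly_conj A uP) -/B BE (@char_poly_lblock 1 m).
have -> : char_poly (mu%:M : 'M[F]_1) = 'X - mu%:P.
  by rewrite /char_poly /char_poly_mx det_mx11 !mxE !eqxx !mulr1n.
rewrite dvdp_mul2l ?polyXsubC_eq0 // dvdp_XsubCl.
apply: iff_trans (right_eigenvector _ _) _; split.
  move=> [w hw w0]; exists (invmx P *m (col_mx 0 w : 'cV_(1 + m))); split.
  - apply: contraNneq w0 => /(congr1 (mulmx P)); rewrite mulKVmx // mulmx0.
    by rewrite -(@col_mx0 _ 1 m) => /eq_col_mx[_ ->].
  - apply: (can_inj (mulKmx uP)); rewrite -scalemxAr mulKVmx //.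
    rewrite !mulmxA -/B BE mul_block_col !mulmx0 !add0r mul0mx hw.
    by rewrite scale_col_mx scaler0.
  - rewrite uE -scalemxAl -mulmxA mulKVmx // /e0 mul_row_col.
    by rewrite mulmx0 mul0mx addr0 scaler0.
move=> [v [v0 Av uv]].
pose w : 'cV_(1 + m) := P *m v.
have w0 : w != 0 by apply: contraNneq v0 => w0; rewrite -(mulKmx uP v) -/w w0 mulmx0.
have uw : usubmx w = 0.
  have : e0 *m w = 0.
    by rewrite /w mulmxA e0P -scalemxAl uv scaler0.
  by rewrite -{1}[w]vsubmxK /e0 mul_row_col mul1mx mul0mx addr0.
have Bw : B *m w = nu *: w by rewrite /B /w -mulmxA mulKmx // -mulmxA Av scalemxAr.
have wE : w = col_mx 0 (dsubmx w) by rewrite -[LHS]vsubmxK uw.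
exists (dsubmx w).
  move: Bw; rewrite {1}BE wE mul_block_col !mulmx0 !add0r scale_col_mx.
  by rewrite col_mxKd => /eq_col_mx[_ ->].
by apply: contraNneq w0 => w0; rewrite wE w0 col_mx0.
Qed.

End EigenvaluePairs.
(** * Commutators and nilpotent matrices *)

Section Commutators.
Variable C : numClosedFieldType.

Section Kleinecke.
Variable n : nat.
Implicit Types (X A Y Z : 'M[C]_n.+1) (p : {poly C}).

Let D A Z := Z * A - A * Z.

Let derivation A Z W : D A (Z * W) = D A Z * W + Z * D A W.
Proof. by rewrite /D mulrBl mulrBr !mulrA [RHS]addrC addrA subrK. Qed.

Lemma commutator_horner X A p : X * (X * A - A * X) = (X * A - A * X) * X ->
  D A (horner_mx X p) = horner_mx X p^`() * (X * A - A * X).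
Proof.
set Y := X * A - A * X => XY.
elim/poly_ind: p => [|p c IH].
  by rewrite deriv0 !rmorph0 /D mul0r mulr0 subrr mul0r.
rewrite derivD derivC addr0 derivM derivX mulr1 !rmorphD !rmorphM /= horner_mx_X.
rewrite horner_mx_C {1}/D mulrDl mulrDr opprD addrACA.
have -> : c%:M * A = A * c%:M by rewrite -[LHS]/(c%:M *m A) -scalar_mxC.
rewrite subrr addr0 -/(D A _) derivation IH -/Y.
by rewrite mulrDl -!mulrA -XY.
Qed.

(** The Kleinecke-Shirokov theorem for matrices: a commutator Y = XA - AX that
    commutes with X is nilpotent. The derivation D maps p(X) to p'(X) Y, so it
    turns a relation p(X) Y ^ m = 0 into p'(X) Y ^ (2 m + 1) = 0 (apply D, then
    multiply by Y ^ m on the left). Start from the characteristic polynomial and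
    differentiate until p is a nonzero constant. *)
Theorem kleinecke X A : X * (X * A - A * X) = (X * A - A * X) * X ->
  exists m, (X * A - A * X) ^+ m = 0.
Proof.
move=> XY; set Y := X * A - A * X in XY *.
suff H d p m : size p = d.+1 -> horner_mx X p * Y ^+ m = 0 -> exists m, Y ^+ m = 0.
  apply: (H n.+1 (char_poly X) 0%N); first exact: size_char_poly.
  by rewrite Cayley_Hamilton mul0r.
elim: d p m => [|d IH] p m sp pY.
  have /eqP/size_poly1P[c c0 pE] := sp.
  exists m; move: pY; rewrite pE horner_mx_C => /(congr1 (mulmx (c^-1)%:M)).
  by rewrite mulmxA -scalar_mxM mulVf // mul1mx mulmx0.
apply: (IH p^`() (m + m).+1).
  apply/eqP; rewrite eqn_leq; apply/andP; split.
    by rewrite -ltnS -sp lt_size_deriv // -size_poly_gt0 sp.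
  have : p^`()`_d != 0.
    rewrite coef_deriv mulrn_eq0 /=.
    by have := lead_coef_eq0 p; rewrite lead_coefE sp /= => ->; rewrite -size_poly_eq0 sp.
  by apply: contraNltn => h; rewrite nth_default.
have cY q : GRing.comm (Y ^+ m) (horner_mx X q).
  exact: (comm_mx_horner q (commr_sym (commrX m (XY : GRing.comm X Y)))).
have : Y ^+ m * D A (horner_mx X p * Y ^+ m) = 0 by rewrite pY /D mul0r mulr0 subrr mulr0.
rewrite derivation mulrDr [X in _ + X]mulrA cY pY mul0r addr0.
rewrite commutator_horner // -/Y !mulrA cY exprS exprD => <-.
rewrite -!mulrA; congr (_ * _); rewrite !mulrA; congr (_ * _).
exact: (commrX m (commr_refl Y)).
Qed.

End Kleinecke.

Lemma closed_eigenvector r (M : 'M[C]_r) : (0 < r)%N -> exists (a : C) (v : 'cV_r),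
  M *m v = a *: v /\ v != 0.
Proof.
move=> r0; have /closed_rootP[a ra] : size (char_poly M) != 1%N.
  by rewrite size_char_poly eqSS -lt0n.
by exists a; have [v] := (right_eigenvector M a).1 ra; exists v.
Qed.

(** The range of a nonzero matrix U, if it is stable under A, contains a right
    eigenvector of A. *)
Lemma stable_eigenvector n (U A W : 'M[C]_n) : U != 0 -> A *m U = U *m W ->
  exists (a : C) (y : 'cV_n), A *m (U *m y) = a *: (U *m y) /\ U *m y != 0.
Proof.
move=> U0 AU; pose Bs := (row_base U^T)^T.
have [S US] : exists S, U = Bs *m S.
  have : (U^T <= row_base U^T)%MS by rewrite eq_row_base.
  by move=> /submxP[S /(congr1 trmx)]; rewrite trmxK trmx_mul; exists S^T.
have [T BT] : exists T, Bs = U *m T.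
  have : (row_base U^T <= U^T)%MS by rewrite eq_row_base.
  by move=> /submxP[T TE]; exists T^T; rewrite /Bs TE trmx_mul trmxK.
have ABs : A *m Bs = Bs *m (S *m W *m T).
  by rewrite -(mulmxA S) (mulmxA Bs) -US mulmxA -AU -mulmxA -BT.
have r0 : (0 < \rank U^T)%N by rewrite lt0n mxrank_eq0 trmx_eq0.
have [a [v [hv v0]]] := closed_eigenvector (S *m W *m T) r0.
exists a, (T *m v); rewrite (mulmxA U) -BT; split.
  by rewrite mulmxA ABs -[LHS]mulmxA hv -scalemxAr.
apply: contraNneq v0 => /(congr1 trmx); rewrite trmx_mul trmxK trmx0 => h.
rewrite -trmx_eq0; apply/eqP; apply: (row_free_inj (row_base_free U^T)).
by rewrite h mul0mx.
Qed.

(** A nonzero nilpotent solution N gives two eigenvalues of A that differ by c,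
    with a left and a right eigenvector that annihilate each other. *)
Lemma nilpotent_solution_pair n (N A G : 'M[C]_n.+1) (c : C) :
  N != 0 -> (exists m, N ^+ m = 0) -> GRing.comm G N ->
  N * A - A * N = c *: N + N * N * G ->
  exists (mu nu : C) (u : 'rV_n.+1) (v : 'cV_n.+1), [/\ mu - nu = c,
    u != 0, v != 0 & [/\ u *m A = mu *: u, A *m v = nu *: v & u *m v = 0]].
Proof.
move=> N0 Nnil GN eqN.
have [m Nm Nm1] : exists2 m, N ^+ m.+1 != 0 & N ^+ m.+2 = 0.
  have exm : exists m, N ^+ m == 0 by case: Nnil => m /eqP; exists m.
  case: (ex_minnP exm) => -[|[|m]] h hmin.
  - by move: h; rewrite expr0 oner_eq0.
  - by move: h; rewrite expr1 (negbTE N0).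
  by exists m; [apply/negP => /hmin; rewrite ltnn|exact/eqP].
pose H : 'M[C]_n.+1 := c%:M + N * G.
have HN : GRing.comm H N.
  apply/commr_sym/commrD; first exact: scalar_mxC.
  by apply: commrM => //; exact: commr_sym.
have NA : N * A = (A + H) * N.
  apply/eqP; rewrite mulrDl addrC -subr_eq eqN /H mulrDl.
  by rewrite -(mulrA N G N) GN mulrA -[c%:M * N]/(c%:M *m N) mul_scalar_mx.
(* N A = (A + H) N with H commuting with N, and H acts as c on the range of
   N ^ (m + 1), because N kills that range. *)
have NkA k : N ^+ k * A = (A + H *+ k) * N ^+ k.
  elim: k => [|k IH]; first by rewrite expr0 mul1r mulr0n addr0 mulr1.
  rewrite exprSr -mulrA NA mulrA mulrDr IH.
  rewrite (commr_sym (commrX k HN)) -mulrDl mulrA; congr (_ * _).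
  by rewrite -addrA -mulrSr.
have HNm : H * N ^+ m.+1 = c *: N ^+ m.+1.
  rewrite /H mulrDl -[N * G]GN -mulrA -exprS Nm1 mulr0 addr0.
  by rewrite -mul_scalar_mx.
have ANm : A *m N ^+ m.+1 = N ^+ m.+1 *m (A - (c *+ m.+1)%:M).
  have := NkA m.+1; rewrite mulrDl mulrnAl HNm scalerMnl => NA1.
  by rewrite mulmxBr mul_mx_scalar -[N ^+ m.+1 *m A]/(_ * _) NA1 addrK.
have [nu [y [Av v0]]] := stable_eigenvector Nm ANm.
set v := N ^+ m.+1 *m y in Av v0; pose z := N ^+ m *m y.
have Nz : N *m z = v by rewrite /z /v mulmxA exprS.
have Nv : N *m v = 0.
  by rewrite /v mulmxA -[N *m _]/(N * _) -exprS Nm1 mul0mx.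
have Hv : H *m v = c *: v.
  by rewrite /v mulmxA -[H *m _]/(H * _) HNm scalemxAl.
pose M := A - (c + nu)%:M.
have NM : N *m M = (M + H) *m N.
  rewrite /M mulmxBr -addrAC mulmxBl -[N *m A]/(N * A) NA.
  by rewrite scalar_mxC.
have NMz : N *m (M *m z) = 0.
  rewrite mulmxA NM -mulmxA Nz /M -addrAC mulmxBl mulmxDl Av Hv.
  by rewrite mul_scalar_mx -scalerDl (addrC nu) subrr.
(* On the row space of N, which is stable under M, the matrix M is singular. *)
have [T BT] : exists T, row_base N = T *m N.
  by apply/submxP; rewrite eq_row_base.
have [S NS] : exists S, N = S *m row_base N.
  by apply/submxP; rewrite eq_row_base.
pose B := row_base N; pose K := T *m (M + H) *m S.
have BM : B *m M = K *m B.
  by rewrite /K -mulmxA -NS -mulmxA -NM mulmxA -BT.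
have Bz0 : B *m z != 0.
  by apply: contraNneq v0 => Bz; rewrite -Nz NS -mulmxA -/B Bz mulmx0.
have /det0P[k k0 kK] : \det K == 0.
  apply/negPn/negP => dK; have uK : K \in unitmx by rewrite unitmxE unitfE.
  move/eqP: Bz0; apply; rewrite -(mulKmx uK (B *m z)) (mulmxA K) -BM -(mulmxA B).
  by rewrite [B]BT -mulmxA NMz !mulmx0.
exists (c + nu), nu, (k *m B), v; split; [by rewrite addrK| |by []|split].
- apply: contraNneq k0 => kB; apply/eqP.
  by apply: (row_free_inj (row_base_free N)); rewrite mul0mx.
- have : k *m B *m M = 0 by rewrite -mulmxA BM mulmxA kK mul0mx.
  by rewrite /M mulmxBr => /eqP; rewrite subr_eq0 mul_mx_scalar => /eqP.
- by [].
- by rewrite /B BT -!mulmxA Nv !mulmx0.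
Qed.

(** Conversely, eigenvectors u and v with u v = 0 give a solution of square 0. *)
Lemma rank_one_solution n (A : 'M[C]_n) (u : 'rV_n) (v : 'cV_n) mu nu :
  u *m A = mu *: u -> A *m v = nu *: v -> u *m v = 0 -> u != 0 -> v != 0 ->
  [/\ v *m u != 0, (v *m u) *m (v *m u) = 0 &
      (v *m u) *m A - A *m (v *m u) = (mu - nu) *: (v *m u)].
Proof.
move=> uA Av uv u0 v0; split.
- apply/eqP => vu; have [j uj] : exists j, u 0 j != 0.
    by apply/existsP; apply: contraNT u0; rewrite negb_exists => /forallP H;
      apply/eqP/rowP => j; rewrite mxE; apply/eqP/negPn/H.
  move/eqP: v0; apply; apply/colP => i; rewrite mxE.
  have := congr1 (fun M : 'M[C]_n => M i j) vu; rewrite /= !mxE big_ord1 => /eqP.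
  by rewrite mulf_eq0 (negbTE uj) orbF => /eqP.
- by rewrite mulmxA -(mulmxA v u v) uv mulmx0 mul0mx.
- by rewrite -mulmxA uA mulmxA Av -scalemxAr -scalemxAl scalerBl.
Qed.

End Commutators.

(** * Functions of a matrix *)

Lemma two_i_pi_neq0 (R : realType) : two_i_pi R != 0.
Proof.
apply/eqP => -[] /eqP; rewrite mulf_eq0 pnatr_eq0 /=.
by rewrite gt_eqF // pi_gt0.
Qed.

Lemma winding_integral (R : realType) (Gamma : seq (R -> R[i])) w :
  winding Gamma w = 1 ->
  contour_integral Gamma (fun z => (z - w)^-1) = two_i_pi R.
Proof.
by rewrite /winding => h; rewrite -[LHS](mulVKf (two_i_pi_neq0 R)) h mulr1.
Qed.

Section MatrixFunction.
Variable R : realType.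
Local Notation C := (R[i]).
Variable n : nat.
Variable X : 'M[C]_n.

Lemma shifted_mx z : z%:M - X = map_mx (horner_eval z) (char_poly_mx X).
Proof.
apply/matrixP => i j; rewrite !mxE /horner_eval !hornerE.
by rewrite hornerMn hornerX.
Qed.

Lemma char_poly_neq0 z : ~ spectrum X z -> (char_poly X).[z] != 0.
Proof. by move=> Xz; apply/negP; rewrite -/(root _ _) -eigenvalue_root_char. Qed.

(** The entries of the resolvent are rational functions of z. *)
Lemma resolventE z i j : (char_poly X).[z] != 0 ->
  invmx (z%:M - X) i j = ((char_poly X).[z])^-1 * (\adj (char_poly_mx X) i j).[z].
Proof.
move=> z0; have dE : \det (z%:M - X) = (char_poly X).[z].
  by rewrite shifted_mx det_map_mx.
rewrite /invmx unitmxE dE unitfE z0 mxE.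
by rewrite shifted_mx -map_mx_adj mxE.
Qed.

Lemma resolvent_unit z : ~ spectrum X z -> z%:M - X \in unitmx.
Proof.
move=> /char_poly_neq0 z0; rewrite unitmxE unitfE shifted_mx.
by rewrite det_map_mx.
Qed.

Lemma resolvent_ccont z i j : ~ spectrum X z ->
  ccont (fun z => invmx (z%:M - X) i j) z.
Proof.
move=> /char_poly_neq0 z0.
have z1 : 0 < cmod (char_poly X).[z] by rewrite cmod_gt0.
have [d d0 Hd] := @ccont_horner _ (char_poly X) z _ z1.
apply: (@ccont_near _ (fun z => ((char_poly X).[z])^-1 *
  (\adj (char_poly_mx X) i j).[z]) _ _ _ d0).
  move=> w /Hd h; rewrite resolventE //; apply: contraTneq h => ->.
  by rewrite sub0r cmodN ltxx.
by apply: ccontM; [apply: ccontV => //|]; exact: ccont_horner.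
Qed.

Section OneContour.
Variables (Omega : set C^o) (f : C -> C) (Gamma : seq (R -> C)).
Hypothesis Omega_open : open Omega.
Hypothesis hf : analytic_on Omega f.
Hypothesis hG : encloses Omega X Gamma.
Local Notation K := (contour_image Gamma).
Local Notation I := (contour_integral Gamma).
Local Notation Y := (cauchy_matrix f X Gamma).

Let hc : closed_contour Gamma. Proof. by case: hG. Qed.
Let KO : K `<=` Omega. Proof. by case: hG => _ H _ _ z /H[]. Qed.
Let KX z : K z -> ~ spectrum X z. Proof. by case: hG => _ H _ _ /H[]. Qed.

Let ipi0 : two_i_pi R != 0 := two_i_pi_neq0 R.

Let Gamma0 w : ~ Omega w -> I (fun z => (z - w)^-1) = 0.
Proof.
case: hG => _ _ _ H /H /eqP; rewrite /winding mulf_eq0 invr_eq0 (negbTE ipi0).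
by move=> /eqP.
Qed.

Let spectrum_off w : spectrum X w -> ~ K w.
Proof. by move=> Xw /KX. Qed.

Let Gamma1 w : spectrum X w -> I (fun z => (z - w)^-1) = two_i_pi R.
Proof. by move=> Xw; apply: winding_integral; case: hG => _ _ H _; exact: H. Qed.

Let fcont : ccontK Gamma f.
Proof. by move=> z /KO Oz; exact: (analytic_ccont hf). Qed.

Let frcont i j : ccontK Gamma (fun z => f z * invmx (z%:M - X) i j).
Proof. by move=> z Kz; apply: ccontM; [exact: fcont|exact/resolvent_ccont/KX]. Qed.

Let lin i j c : c * I (fun z => f z * invmx (z%:M - X) i j) =
  I (fun z => f z * (c * invmx (z%:M - X) i j)).
Proof.
rewrite -contour_integralZ //; apply: eq_contour_integral => z _.
by rewrite mulrCA.
Qed.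

Let lin_cont i j c : ccontK Gamma (fun z => f z * (c * invmx (z%:M - X) i j)).
Proof.
move=> z Kz; apply: ccontM; first exact: fcont.
by apply: ccontM; [exact: ccont_cst|exact/resolvent_ccont/KX].
Qed.

Lemma cauchy_matrix_mull m (M : 'M[C]_(m, n)) i j : (M *m Y) i j =
  (two_i_pi R)^-1 * I (fun z => f z * (M *m invmx (z%:M - X)) i j).
Proof.
rewrite mxE; under eq_bigr => k _ do rewrite mxE mulrCA lin.
rewrite -mulr_sumr -contour_integral_sum //; congr (_ * _).
by apply: eq_contour_integral => z _; rewrite mxE mulr_sumr.
Qed.

Lemma cauchy_matrix_mulr m (M : 'M[C]_(n, m)) i j : (Y *m M) i j =
  (two_i_pi R)^-1 * I (fun z => f z * (invmx (z%:M - X) *m M) i j).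
Proof.
rewrite mxE; under eq_bigr => k _ do rewrite mxE -mulrA (mulrC _ (M k j)) lin.
rewrite -mulr_sumr -contour_integral_sum //; congr (_ * _).
apply: eq_contour_integral => z _; rewrite mxE mulr_sumr.
by apply: eq_bigr => k _; rewrite (mulrC (M k j)).
Qed.

Lemma cauchy_matrix_comm : X *m Y = Y *m X.
Proof.
apply/matrixP => i j; rewrite cauchy_matrix_mull cauchy_matrix_mulr.
congr (_ * _); apply: eq_contour_integral => z Kz; congr (_ * fun_of_matrix _ i j).
have U := resolvent_unit (KX Kz).
apply: (can_inj (mulKmx U)); rewrite mulKVmx // mulmxA.
have -> : (z%:M - X) *m X = X *m (z%:M - X).
  by rewrite mulmxBl mulmxBr scalar_mxC.
by rewrite -mulmxA mulmxV // mulmx1.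
Qed.

(** Spectral mapping, on eigenvectors. *)
Lemma cauchy_matrix_eigen (v : 'rV_n) l : v != 0 -> v *m X = l *: v ->
  Omega l -> v *m Y = f l *: v.
Proof.
move=> v0 vX Ol; have Xl : spectrum X l by apply/eigenvalueP; exists v.
have Kl := spectrum_off Xl.
apply/rowP => j; rewrite cauchy_matrix_mull mxE.
rewrite (@eq_contour_integral _ _ _ (fun z => v 0 j * (f z * (z - l)^-1))).
  rewrite contour_integralZ //; last first.
    by move=> z Kz; apply: ccontM; [exact: fcont|exact: (ccontK_inv Kl)].
  rewrite (cauchy_formula hc Omega_open hf KO Gamma0 Ol Kl) Gamma1 //.
  by field; exact: ipi0.
move=> z Kz; have zl : z - l != 0.
  by rewrite subr_eq0; apply/eqP => zl; apply: Kl; rewrite -zl.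
have -> : v *m invmx (z%:M - X) = (z - l)^-1 *: v.
  have U := resolvent_unit (KX Kz).
  apply: (can_inj (mulmxK U)); rewrite mulmxKV // -scalemxAl mulmxBr.
  by rewrite mul_mx_scalar vX -scalerBl scalerA mulVf // scale1r.
by rewrite mxE; ring.
Qed.

(** The value of f at alpha I + N, with N nilpotent, is a polynomial in N, whose
    first two coefficients are f(alpha) and f'(alpha). *)
Lemma cauchy_matrix_nilpotent (alpha : C) m : Omega alpha -> ~ K alpha ->
  I (fun z => (z - alpha)^-1) = two_i_pi R ->
  (X - alpha%:M) ^+ m = 0 ->
  exists c : nat -> C, [/\ c 0%N = f alpha, c 1%N = cderiv f alpha &
    Y = \sum_(k < m) c k *: (X - alpha%:M) ^+ k].
Proof.
move=> Oa Ka Ia; set N := X - alpha%:M => Nm.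
pose c k := (two_i_pi R)^-1 * I (fun z => f z * (z - alpha)^-1 ^+ k.+1).
have cc k : ccontK Gamma (fun z => f z * (z - alpha)^-1 ^+ k).
  by move=> z Kz; apply: ccontM; [exact: fcont|exact: (ccontK_invX k Ka)].
have cc' k b : ccontK Gamma (fun z => b * (f z * (z - alpha)^-1 ^+ k)).
  by move=> z Kz; apply: ccontM; [exact: ccont_cst|exact: cc].
exists c; split.
- rewrite /c (@eq_contour_integral _ _ _ (fun z => f z * (z - alpha)^-1)).
    rewrite (cauchy_formula hc Omega_open hf KO Gamma0 Oa Ka) Ia.
    by field; exact: ipi0.
  by move=> z _; rewrite expr1.
- rewrite /c (cauchy_formula_deriv hc Omega_open hf KO Gamma0 Oa Ka) Ia.
  by field; exact: ipi0.
apply/matrixP => i j; rewrite summxE mxE.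
under eq_bigr => k _ do rewrite mxE /c -mulrA [X in _ * X]mulrC -contour_integralZ //.
rewrite -mulr_sumr -contour_integral_sum //; congr (_ * _).
apply: eq_contour_integral => z Kz.
have za : z - alpha != 0.
  by rewrite subr_eq0; apply/eqP => za; apply: Ka; rewrite -za.
suff -> : invmx (z%:M - X) = \sum_(k < m) (z - alpha)^-1 ^+ k.+1 *: N ^+ k.
  rewrite summxE mulr_sumr; apply: eq_bigr => k _.
  by rewrite mxE mulrC -mulrA mulrC mulrA.
have U := resolvent_unit (KX Kz).
apply: (can_inj (mulKmx U)); rewrite mulmxV //.
have -> : z%:M - X = (z - alpha)%:M - N.
  by rewrite /N raddfB /= opprB addrA subrK.
suff H d : ((z - alpha)%:M - N) *m (\sum_(k < d) (z - alpha)^-1 ^+ k.+1 *: N ^+ k) =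
    1%:M - (z - alpha)^-1 ^+ d *: N ^+ d.
  by rewrite H Nm scaler0 subr0.
elim: d => [|d IH]; first by rewrite big_ord0 mulmx0 !expr0 scale1r subrr.
rewrite big_ord_recr /= mulmxDr IH mulmxBl mul_scalar_mx scalerA exprS mulVKf //.
by rewrite -scalemxAr -[N *m _]/(N * _) -(exprS N) addrA subrK.
Qed.

End OneContour.
End MatrixFunction.

(** * Circles *)

Section Circle.
Variable R : realType.
Local Notation C := (R[i]).

(** The circle of centre c and radius r, as a closed contour. *)
Definition circle (c : C) (r : R) : seq (R -> C) :=
  [:: fun t => (complex.Re c + r * cos (2 * pi * t)) +i*
               (complex.Im c + r * sin (2 * pi * t))].

Variables (c : C) (r : R).
Hypothesis r0 : 0 < r.

Let g (t : R) : C := (complex.Re c + r * cos (2 * pi * t)) +i*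
               (complex.Im c + r * sin (2 * pi * t)).

Let dlin t : is_derive t (1 : R) (fun s : R => 2 * pi * s) (2 * pi).
Proof.
by have := is_deriveZ (2 * pi : R) (is_derive_id t (1 : R)); rewrite /GRing.scale /= mulr1.
Qed.

Let dcos (a : R) t : is_derive t (1 : R) (fun s => a + r * cos (2 * pi * s))
  (- (2 * pi * r * sin (2 * pi * t))).
Proof.
have d1 := is_derive1_comp (is_derive_cos (2 * pi * t)) (dlin t).
apply: is_derive_eq (is_deriveD (is_derive_cst a t (1 : R)) (is_deriveZ r d1)) _.
by rewrite /GRing.scale /=; ring.
Qed.

Let dsin (a : R) t : is_derive t (1 : R) (fun s => a + r * sin (2 * pi * s))
  (2 * pi * r * cos (2 * pi * t)).
Proof.
have d1 := is_derive1_comp (is_derive_sin (2 * pi * t)) (dlin t).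
apply: is_derive_eq (is_deriveD (is_derive_cst a t (1 : R)) (is_deriveZ r d1)) _.
by rewrite /GRing.scale /=; ring.
Qed.

Let kcont (k : R) (u u' : R -> R) : (forall t, is_derive t (1 : R) u (u' t)) ->
  continuous (fun t => k * u t).
Proof.
move=> du t; apply: continuousM; first exact: cst_continuous.
by apply: differentiable_continuous; apply/derivable1_diffP; exact: @ex_derive.
Qed.

Lemma circle_C1 : C1_arc g.
Proof.
split; split=> [t|].
- by have := dcos (complex.Re c) t => d; exact: @ex_derive.
- rewrite (_ : derive1 _ = fun t => - (2 * pi) * (0 + r * sin (2 * pi * t))).
    exact: kcont (dsin 0).
  apply/funext => t; rewrite derive1E.
  by have d := dcos (complex.Re c) t; rewrite derive_val; ring.
- by have := dsin (complex.Im c) t => d; exact: @ex_derive.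
- rewrite (_ : derive1 _ = fun t => 2 * pi * (0 + r * cos (2 * pi * t))).
    exact: kcont (dcos 0).
  apply/funext => t; rewrite derive1E.
  by have d := dsin (complex.Im c) t; rewrite derive_val; ring.
Qed.

Lemma circle_closed : closed_contour (circle c r).
Proof.
split; first by case=> // _; exact: circle_C1.
rewrite /= andbT eq_complex /= !mulr1 !mulr0 cos0 sin0.
by rewrite (mulrC 2) mulr_natr cos2pi sin2pi mulr1 mulr0 !eqxx.
Qed.

Lemma circle_image z : contour_image (circle c r) z -> cmod (z - c) = r.
Proof.
move=> [[|k] [t []]] // _ _ ->; rewrite /cmod; case: (c) => a b /=.
rewrite ![_ + _ * _ - _]addrAC !subrr !add0r !exprMn -mulrDr cos2Dsin2 mulr1.
by rewrite sqrtr_sqr gtr0_norm.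
Qed.

Lemma circle_winding : winding (circle c r) c = 1.
Proof.
rewrite /winding /contour_integral big_seq1 -[X in _ * X = _](_ : two_i_pi R = _).
  by rewrite mulVf ?two_i_pi_neq0.
rewrite -[LHS]cintegral01_cst; apply: eq_cintegral01 => t t01; rewrite -/(g t).
have gc : g t - c != 0.
  by rewrite -cmod_gt0 (@circle_image (g t)) //; exists 0%N, t.
have -> : arc_deriv g t = two_i_pi R * (g t - c).
  have d1 := dcos (complex.Re c) t; have d2 := dsin (complex.Im c) t.
  rewrite /arc_deriv !derive1E !derive_val /two_i_pi /g.
  case: (c) => a b /=; rewrite /GRing.mul /=.
  by congr (_ +i* _); rewrite -!/(GRing.mul _ _); ring.
by rewrite mulrCA mulVf // mulr1.
Qed.

End Circle.

(** * The commutator equation *)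

(** If X - alpha I is nilpotent, then alpha is the only possible eigenvalue. *)
Lemma spectrum_nilpotent (R : realType) n (X : 'M[R[i]]_n) (alpha z : R[i]) m :
  (X - alpha%:M) ^+ m = 0 -> spectrum X z -> z = alpha.
Proof.
move=> Nm /eigenvalueP[v vX v0].
have vN k : v *m (X - alpha%:M) ^+ k = (z - alpha) ^+ k *: v.
  elim: k => [|k IH]; first by rewrite !expr0 mulmx1 scale1r.
  rewrite exprSr mulmxA IH -scalemxAl mulmxBr vX mul_mx_scalar -scalerBl.
  by rewrite scalerA -exprSr.
have := vN m; rewrite Nm mulmx0 => /esym/eqP.
by rewrite scaler_eq0 (negbTE v0) orbF expf_eq0 subr_eq0 => /andP[_ /eqP].
Qed.

(** The converse, by the Cayley-Hamilton theorem. *)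
Lemma nilpotent_spectrum (R : realType) n (X : 'M[R[i]]_n.+1) (alpha : R[i]) :
  (forall z, spectrum X z -> z = alpha) -> (X - alpha%:M) ^+ n.+1 = 0.
Proof.
move=> Xa; have [s sE] := closed_field_poly_normal (char_poly X).
have {}sE : char_poly X = \prod_(z <- s) ('X - z%:P).
  by rewrite [LHS]sE (monicP (char_poly_monic X)) scale1r.
have sa z : z \in s -> z = alpha.
  by move=> zs; apply: Xa; rewrite /spectrum /= eigenvalue_root_char sE root_prod_XsubC.
have {}sE : char_poly X = ('X - alpha%:P) ^+ size s.
  rewrite sE (eq_big_seq (fun=> 'X - alpha%:P)) => [|z /sa -> //].
  by rewrite big_const_seq count_predT iter_mulr_1.
have ss : size s = n.+1.
  by apply: succn_inj; rewrite -(size_exp_XsubC (size s) alpha) -sE size_char_poly.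
by have := Cayley_Hamilton X; rewrite sE ss rmorphXn rmorphB /= horner_mx_X horner_mx_C.
Qed.

Theorem theorem2 (R : realType) (n : nat) (hn : (2 <= n)%N)
    (Omega : set R[i]^o) (hOmega : is_domain Omega)
    (f : R[i] -> R[i]) (hf : analytic_on Omega f)
    (alpha : R[i]) (halpha : Omega alpha) (hzero : f alpha = 0)
    (huniq : forall z : R[i], Omega z -> f z = 0 -> z = alpha)
    (A : 'M[R[i]]_n) (lambda : 'I_n -> R[i])
    (hlambda : char_poly A = \prod_(i < n) ('X - (lambda i)%:P)) :
  (exists X : 'M[R[i]]_n,
     [/\ spectrum X `<=` Omega,
         is_matrix_function Omega f X (X *m A - A *m X) &
         X <> alpha%:M]) <->
  (exists i j : 'I_n, i <> j /\ lambda i - lambda j = cderiv f alpha).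
Proof.
have [Oopen _ _] := hOmega.
case: n hn A lambda hlambda => [|[|n]] // _ A lambda hlambda; split.
- move=> [X [XO [Gamma hG Yeq] Xa]].
  have [hc KOX G1 G0] := hG.
  set Y := cauchy_matrix f X Gamma in Yeq.
  have [m Ym] : exists m, Y ^+ m = 0.
    have XY : X * Y = Y * X by exact: (cauchy_matrix_comm hf hG).
    by have := @kleinecke _ _ X A; rewrite -[X * A - A * X]/(X *m A - A *m X) Yeq; exact.
  (* By spectral mapping, f vanishes on the spectrum of X. *)
  have Xspec z : spectrum X z -> z = alpha.
    move=> Xz; have Oz := XO z Xz; have /eigenvalueP[v vX v0] := Xz.
    apply: huniq => //.
    have vY k : v *m Y ^+ k = f z ^+ k *: v.
      elim: k => [|k IH]; first by rewrite !expr0 mulmx1 scale1r.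
      rewrite exprSr mulmxA IH -scalemxAl (cauchy_matrix_eigen Oopen hf hG v0 vX Oz).
      by rewrite scalerA -exprSr.
    have := vY m; rewrite Ym mulmx0 => /esym/eqP.
    by rewrite scaler_eq0 (negbTE v0) orbF expf_eq0 => /andP[_ /eqP].
  (* Hence X = alpha I + N with N nilpotent, and the equation becomes one on N. *)
  pose N := X - alpha%:M.
  have Nn : N ^+ n.+2 = 0 by exact: nilpotent_spectrum.
  have N0 : N != 0 by rewrite subr_eq0; apply/eqP.
  have Xalpha : spectrum X alpha.
    have [a [v]] := closed_eigenvector X (ltn0Sn n.+1).
    move=> [Xv v0]; have Xa' : spectrum X a.
      by rewrite /spectrum /= eigenvalue_root_char; apply/right_eigenvector; exists v.
    by rewrite -(Xspec a Xa').
  have Ka : ~ contour_image Gamma alpha by move=> /KOX[].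
  have [c [c0 c1 YE]] := cauchy_matrix_nilpotent Oopen hf hG halpha Ka
    (winding_integral (G1 _ Xalpha)) Nn.
  pose G := \sum_(k < n) c k.+2 *: N ^+ k.
  have GN : GRing.comm G N.
    rewrite /G; apply/commr_sym/commr_sum => k _.
    rewrite /GRing.comm -scalerAl -scalerAr; congr (_ *: _).
    exact: commrX (commr_refl N).
  have eqN : N * A - A * N = cderiv f alpha *: N + N * N * G.
    rewrite (_ : N * A - A * N = X *m A - A *m X); last first.
      have cA : alpha%:M * A = A * alpha%:M by exact/esym/scalar_mxC.
      by rewrite /N mulrBl mulrBr cA opprB addrA subrK.
    rewrite Yeq /Y YE -/N big_ord_recl c0 hzero scale0r add0r.
    rewrite big_ord_recl /= c1 expr1; congr (_ + _).
    rewrite /G mulr_sumr; apply: eq_bigr => k _.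
    by rewrite -scalerAr -mulrA -!exprS.
  have [mu [nu [u [v [muc u0 v0 [uA Av uv]]]]]] :=
    nilpotent_solution_pair N0 (ex_intro _ _ Nn) GN eqN.
  have [i [j [ij li lj]]] := (eigenvalue_pair mu nu hlambda).2
    (ex_intro _ u (ex_intro _ v (And5 u0 v0 uA Av uv))).
  by exists i, j; split=> //; rewrite li lj.
- move=> [i [j [ij lij]]].
  have [u [v [u0 v0 uA Av uv]]] := (eigenvalue_pair _ _ hlambda).1
    (ex_intro _ i (ex_intro _ j (And3 ij erefl erefl))).
  have [N0 NN eqN] := rank_one_solution uA Av uv u0 v0.
  set N := v *m u in N0 NN eqN.
  pose X := alpha%:M + N.
  have XN : X - alpha%:M = N by rewrite /X addrAC subrr add0r.
  have Xa z : spectrum X z -> z = alpha.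
    by apply: (@spectrum_nilpotent _ _ X alpha z 2); rewrite XN expr2.
  (* A small circle around alpha encloses the spectrum of X, which is {alpha}. *)
  have /nbhs_cmod[d d0 Hd] : nbhs (alpha : R[i]^o) Omega by exact: open_nbhs_nbhs.
  pose r := d / 2; have r0 : 0 < r by rewrite divr_gt0.
  have cc := circle_closed alpha r.
  have Kr z : contour_image (circle alpha r) z -> cmod (z - alpha) = r.
    exact: circle_image.
  have Ka : ~ contour_image (circle alpha r) alpha.
    by move=> /Kr; rewrite subrr cmod0 => r00; rewrite -r00 ltxx in r0.
  have hG : encloses Omega X (circle alpha r).
    split=> //.
    + move=> z Kz; split; first by apply: Hd; rewrite Kr // /r; lra.
      by move=> /Xa za; move: Kz; rewrite za.
    + by move=> w /Xa ->; exact: circle_winding.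
    + move=> w Ow; rewrite /winding (@winding_outside_disc _ _ cc alpha r).
      * by rewrite mulr0.
      * by move=> z /Kr ->.
      * rewrite ltNge; apply/negP => wr; apply: Ow; apply: Hd.
        by apply: le_lt_trans wr _; rewrite /r; lra.
  exists X; split.
  + by move=> z /Xa ->.
  + exists (circle alpha r) => //.
    have XN2 : (X - alpha%:M) ^+ 2 = 0 by rewrite XN expr2.
    have [c [c0 c1 ->]] := cauchy_matrix_nilpotent Oopen hf hG halpha Ka
      (winding_integral (circle_winding alpha r0)) XN2.
    rewrite big_ord_recl big_ord1 /= c0 hzero scale0r add0r c1 XN expr1 -lij.
    rewrite -eqN /X mulmxDl mulmxDr opprD addrACA.
    by rewrite -scalar_mxC subrr add0r.
  + by move=> XE; move: N0; rewrite -XN XE subrr eqxx.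
Qed.
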